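(* Let $X$ be a CB process with branching mechanism $\Phi$ given by $(\alpha,\beta,\pi)$, with natural filtration $(\mathcal{F}_t)$, and let $x>0$. Assume that $\alpha\ge0$ and that there is a constant $\lambda'>0$ such that $\Phi(\lambda)>0$ for $\lambda\ge\lambda'$ and $\int_{\lambda'}^\infty\frac{d\lambda}{\Phi(\lambda)}<\infty$. Let $H=\inf\{s>0:X_s=0\}$. Then for any $t\in[0,\infty)$ and any $\mathcal{F}_t$-measurable bounded random variable $F$, as $r\to\infty$, $$\mathbf{E}_x[F\mid H=r]\to\frac1x\,\mathbf{E}_x[e^{\alpha t}X_tF]\quad\text{and}\quad\mathbf{E}_x[F\mid H>r]\to\frac1x\,\mathbf{E}_x[e^{\alpha t}X_tF].$$
   Context: A branching mechanism is a function $\Phi(\lambda)=\alpha\lambda+\beta\lambda^2+\int_{(0,\infty)}(e^{-\lambda\theta}-1+\lambda\theta)\,\pi(d\theta)$, $\lambda\ge0$, with $\alpha\in\mathbb{R}$, $\beta\ge0$ and $\pi$ a $\sigma$-finite measure on $(0,\infty)$ (the Lévy measure) with $\int_{(0,\infty)}(\theta\wedge\theta^2)\,\pi(d\theta)<\infty$; the case $\Phi\equiv0$ is excluded. A CB process with branching mechanism $\Phi$ is an rcll $[0,\infty)$-valued Markov process $X=(X_t)_{t\ge0}$ such that, writing $\mathbf{P}_x$ for its law when $X_0=x$ and $\mathbf{E}_x$ for the expectation, $\mathbf{E}_x[e^{-\lambda X_t}]=e^{-xv_t(\lambda)}$ for $\lambda\ge0$, where $v_t(\lambda)$ is the unique locally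 bounded nonnegative solution of $v_t(\lambda)=\lambda-\int_0^t\Phi(v_s(\lambda))\,ds$. Under the assumptions of the claim, $H$ is a.s. finite and, with $\overline v_t=\lim_{\lambda\to\infty}v_t(\lambda)<\infty$ for $t>0$, has the positive continuous density $h_x(t)=xe^{-x\overline v_t}\Phi(\overline v_t)$, $t>0$, under $\mathbf{P}_x$. $\mathbf{E}_x[F\mid H=r]$ denotes the conditional expectation of $F$ given $H=r$ (from a disintegration of $\mathbf{P}_x$ with respect to $H$); it is determined for Lebesgue-almost every $r>0$, and the limit $r\to\infty$ is understood accordingly, i.e. off a null set of values $r$. *)

(* Defs.v *)
From HB Require Import structures.
From mathcomp Require Import all_boot all_order all_algebra.
From mathcomp Require Import all_classical all_reals all_analysis measurable_realfun.

Set Implicit Arguments.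
Unset Strict Implicit.
Unset Printing Implicit Defensive.

Import Order.TTheory GRing.Theory Num.Theory.
Import numFieldNormedType.Exports.

Local Open Scope classical_set_scope.
Local Open Scope ring_scope.

(** Times, states and Laplace variables are real numbers;
    all conditions are imposed on [0, +oo) only, so the values of the functions
    below at negative arguments are irrelevant. *)

Section branching_mechanism.
Context {R : realType}.
Implicit Types (pi : {measure set (measurableTypeR R) -> \bar R}).

(** Only the restriction of [pi] to (0, +oo) is used. *)
Definition branching_fun (alpha beta : R) pi (l : R) : R :=
  alpha * l + beta * l ^+ 2 +
  \int[pi]_(theta in `]0, +oo[) (expR (- l * theta) - 1 + l * theta).

Record branching_mechanism (alpha beta : R) pi : Prop := BranchingMechanism {
  branching_beta_ge0 : 0 <= beta ;
  branching_sigma_finite :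
    sigma_finite (`]0%R, +oo[%classic : set (measurableTypeR R)) pi ;
  branching_levy :
    (\int[pi]_(theta in `]0%R, +oo[) (Num.min theta (theta ^+ 2))%:E < +oo)%E ;
  branching_neq0 : exists2 l : R, 0 <= l & branching_fun alpha beta pi l != 0 }.

(** [u] is a locally bounded nonnegative solution, on [0, +oo), of
    u t = l - \int_0^t Phi (u s) ds. *)
Record cumulant_solution (Phi : R -> R) (l : R) (u : R -> R) : Prop :=
  CumulantSolution {
  cumulant_measurable : measurable_fun (`[0, +oo[ : set R) u ;
  cumulant_ge0 : forall t : R, 0 <= t -> 0 <= u t ;
  cumulant_locally_bounded :
    forall T : R, 0 <= T -> exists M, forall t : R, 0 <= t <= T -> u t <= M ;
  cumulant_eq : forall t : R, 0 <= t ->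
    u t = l - \int[lebesgue_measure]_(s in `[0, t]) Phi (u s) }.

End branching_mechanism.

Section process.
Context {R : realType} {d : measure_display} {Omega : measurableType d}.
Implicit Types (X : R -> Omega -> R) (P : R -> probability Omega R).

Definition natural_filtration X (t : R) : set_system Omega :=
  <<s \bigcup_(s in `[0, t]) preimage_set_system setT (X s) measurable >>.

Definition filtration_measurable X (t : R) (F : Omega -> R) : Prop :=
  preimage_set_system setT F measurable `<=` natural_filtration X t.

Definition rcll (f : R -> R) : Prop :=
  (forall t : R, 0 <= t -> f s @[s --> t^'+] --> f t) /\
  (forall t : R, 0 < t -> cvg (f s @[s --> t^'-])).

(** Canonical formulation of a time-homogeneous Markov process: a single
    process [X] on [Omega] with one law [P x] for each initial state [x >= 0].
    In [markov_property] the inner probability is the transition function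
    evaluated at the random state [X s w]. *)
Record markov_process X P : Prop := MarkovProcess {
  markov_measurable : forall t : R, 0 <= t -> measurable_fun setT (X t) ;
  markov_ge0 : forall (t : R) w, 0 <= t -> 0 <= X t w ;
  markov_rcll : forall w, rcll (X ^~ w) ;
  markov_start : forall x : R, 0 <= x -> P x [set w | X 0 w = x] = 1%E ;
  markov_transition_measurable : forall (t : R) (B : set R), 0 <= t -> measurable B ->
    measurable_fun (`[0, +oo[ : set R) (fun x : R => P x (X t @^-1` B)) ;
  markov_property : forall (x s t : R) (A : set Omega) (B : set R),
    0 <= x -> 0 <= s -> 0 <= t ->
    natural_filtration X s A -> measurable B ->
    P x (A `&` X (s + t) @^-1` B)
    = (\int[P x]_(w in A) P (X s w) (X t @^-1` B))%E }.

Record CB_process (Phi : R -> R) X P : Prop := CBProcess {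
  CB_markov : markov_process X P ;
  CB_laplace : exists2 v : R -> R -> R,
    forall l : R, 0 <= l -> cumulant_solution Phi l (v ^~ l) &
    forall x t l : R, 0 <= x -> 0 <= t -> 0 <= l ->
      ('E_(P x) [fun w => expR (- l * X t w)] = (expR (- x * v t l))%:E)%E }.

(** The infimum of the empty set is +oo. *)
Definition extinction_time X (w : Omega) : \bar R :=
  ereal_inf [set s%:E | s in [set s | 0 < s /\ X s w = 0]].

End process.

(** The two conditional expectations below are applied to the extinction time
    [H] of an rcll process, which agrees almost surely with a measurable
    function (zero is absorbing) but need not be measurable itself when
    [Omega] is not complete. They are therefore written with integrals only:
    the integral of a nonnegative function is the supremum of the integrals of
    the measurable simple functions below it, hence has its usual value for
    functions that are a.s. equal to a measurable one, whereas [Q A] would be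
    meaningless for a nonmeasurable [A]. *)
Section conditional_expectation.
Context {R : realType} {d : measure_display} {Omega : measurableType d}.
Implicit Types (Q : probability Omega R) (F : Omega -> R).

(** E[F | A] = E[F 1_A] / E[1_A], for an event of positive probability. *)
Definition cond_expectation_event Q F (A : set Omega) : R :=
  fine 'E_Q [F \* \1_A] / fine 'E_Q [\1_A].

(** [g] is a version of r |-> E[F | H = r]: g is a Borel function with
    E[F; H \in B] = E[g(H); H \in B] for every Borel set B of real numbers. *)
Definition cond_expectation_given Q F (H : Omega -> \bar R) (g : R -> R) : Prop :=
  measurable_fun setT g /\
  forall B : set R, measurable B ->
    (\int[Q]_(w in H @^-1` (EFin @` B)) (F w)%:E
     = \int[Q]_(w in H @^-1` (EFin @` B)) (g (fine (H w)))%:E)%E.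

End conditional_expectation.

(* Main.v *)
Require Import Defs.
From HB Require Import structures.
From mathcomp Require Import all_boot all_order all_algebra.
From mathcomp Require Import all_classical all_reals all_analysis measurable_realfun.
From mathcomp Require Import ring lra.

Set Implicit Arguments.
Unset Strict Implicit.
Unset Printing Implicit Defensive.

Import Order.TTheory GRing.Theory Num.Theory.
Import numFieldNormedType.Exports.

Local Open Scope classical_set_scope.
Local Open Scope ring_scope.

(** Write [r_s] for the limit of [v_s (l)] as [l] tends to infinity; it is finite by
    Grey's condition, [P_y (X_s = 0) = exp (- y r_s)], and [r_{s+t} = v_t (r_s)].
    Since zero is absorbing, [H > s] and [X_s <> 0] agree almost surely. For
    [F >= 0] measurable at time [t] the Markov property gives
    [E_x [F; a < H <= b] = E_x [F (exp (- X_t q) - exp (- X_t p))]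
       <= (p - q) E_x [X_t F]] with [p = r_{a-t}], [q = r_{b-t}], whereas
    [P_x (a < H <= b) >= x (r_a - r_b) exp (- x r_a)]. As [r_a - r_b = v_t (p) - v_t (q)],
    Gronwall's lemma bounds [(p - q) / (r_a - r_b)] by [exp (Phi' (p) t)], which
    tends to [exp (alpha t)] because [p] tends to zero. So for large [a] the measure
    [E_x [F; H \in .]] is at most [(x^-1 E_x [exp (alpha t) X_t F] + e) P_x (H \in .)]
    on intervals of [(a, +oo)], hence on its Borel sets; this bounds both
    conditional expectations from above. Adding constants to [F] removes the sign
    condition, because [E_x X_t <= x exp (- alpha t)], and replacing [F] by [- F]
    gives the lower bounds. *)

(** * The branching mechanism *)

Section levy_integrand.
Context {R : realType}.
Implicit Types (l p q u theta : R).

(** A version [g] of the conditional expectation is known only through its integrals over events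
    [H \in B], so pointwise bounds on [g] have to be extracted from bounds on measures: a Borel set
    where [g] is too large, far enough to the right, is null for the law of [H], and it is
    Lebesgue-null because that law dominates a positive multiple of Lebesgue measure on each []r1,
    n]]. On the side of the process, [H] is an infimum over uncountably many times, while the Markov
    property acts at fixed ones. Absorption at zero rests on a tail bound uniform in time, [P_y (X_s
    > delta) <= y / (1 - exp (- delta))]: applied at the first time of a grid at which [X] is below
    [eps], it makes a later rise above [delta] unlikely. Off a null set [H] then equals a measurable
    [T], and events about [T] become events about [X] at fixed times. Convexity of [Phi] enters
    through bounds on its increments alone: slopes at least [alpha], and at most the derivative at
    the right end. *)

Definition levy_integrand l theta : R := expR (- l * theta) - 1 + l * theta.

(** The derivative of [levy_integrand] in its first argument, taken at [p]. *)
Definition levy_slope p theta : R := theta * (1 - expR (- p * theta)).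

Lemma levy_integrand0 theta : levy_integrand 0 theta = 0.
Proof. by rewrite /levy_integrand oppr0 !mul0r expR0 subrr addr0. Qed.

Lemma levy_integrand_ge0 l theta : 0 <= levy_integrand l theta.
Proof.
rewrite /levy_integrand mulNr; have := expR_ge1Dx (- (l * theta)); lra.
Qed.

(** The integrand is convex and nondecreasing in [l], so its secant slope over [[q, p]] lies between
    0 and the derivative at [p]. Both bounds come from [1 + y <= expR y], at
    [y = p * theta - q * theta] and at its opposite. *)
Lemma levy_integrand_slope q p theta : 0 <= q -> q <= p -> 0 <= theta ->
  0 <= levy_integrand p theta - levy_integrand q theta
    <= (p - q) * levy_slope p theta.
Proof.
move=> q0 qp t0; rewrite /levy_integrand /levy_slope !mulNr.
have a0 : 0 <= q * theta by rewrite mulr_ge0.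
have ab : q * theta <= p * theta by rewrite ler_wpM2r.
have -> : (p - q) * (theta * (1 - expR (- (p * theta))))
    = (p * theta - q * theta) * (1 - expR (- (p * theta))) by lra.
move: (p * theta) (q * theta) a0 ab => b a a0 ab.
have eb : expR (- a) = expR (- b) * expR (b - a) by rewrite -expRD; congr expR; lra.
have ea : expR (- b) = expR (- a) * expR (a - b) by rewrite -expRD; congr expR; lra.
have h1 := expR_ge1Dx (b - a); have h2 := expR_ge1Dx (a - b).
have pa := expR_gt0 (- a); have pb := expR_gt0 (- b).
have la : expR (- a) <= 1 by rewrite expR_le1; lra.
apply/andP; split; first by nra.
have : 0 <= expR (- b) * (expR (b - a) - (1 + (b - a))) by apply: mulr_ge0; lra.
by rewrite mulrBr -eb; lra.
Qed.

Lemma levy_slope_ge0 p theta : 0 <= p -> 0 <= theta -> 0 <= levy_slope p theta.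
Proof.
move=> p0 t0; rewrite /levy_slope mulr_ge0// subr_ge0 expR_le1 mulNr oppr_le0.
exact: mulr_ge0.
Qed.

Lemma levy_slope_nondecr q p theta : q <= p -> 0 <= theta ->
  levy_slope q theta <= levy_slope p theta.
Proof.
move=> qp t0; rewrite /levy_slope ler_wpM2l// lerD2l lerN2 ler_expR !mulNr lerN2.
exact: ler_wpM2r.
Qed.

(** [1 - expR (- u)] is at most 1 and at most [u]: the first bound serves where the minimum is
    [theta], the second where it is [theta ^+ 2]. *)
Lemma levy_slope_le p theta : 0 <= p -> 0 <= theta ->
  levy_slope p theta <= Num.max 1 p * Num.min theta (theta ^+ 2).
Proof.
move=> p0 t0; rewrite /levy_slope mulNr.
have h := expR_ge1Dx (- (p * theta)); have e0 := expR_gt0 (- (p * theta)).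
have m1 : 1 <= Num.max 1 p by rewrite le_max lexx.
have mp : p <= Num.max 1 p by rewrite le_max lexx orbT.
move: (Num.max 1 p) m1 mp => m m1 mp.
have [tt|tt] := leP theta (theta ^+ 2).
  have -> : m * theta = theta * m by rewrite mulrC.
  by apply: ler_wpM2l => //; lra.
have -> : m * theta ^+ 2 = theta * (m * theta) by rewrite expr2; lra.
apply: ler_wpM2l => //.
have : p * theta <= m * theta by exact: ler_wpM2r.
lra.
Qed.

Lemma levy_integrand_le p theta : 0 <= p -> 0 <= theta ->
  levy_integrand p theta <= p * (Num.max 1 p * Num.min theta (theta ^+ 2)).
Proof.
move=> p0 t0; have /andP[_] := levy_integrand_slope (lexx 0) p0 t0.
rewrite levy_integrand0 !subr0 => /le_trans; apply.
by rewrite ler_wpM2l// levy_slope_le.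
Qed.

Lemma levy_integrand_double l theta : 0 <= l -> 0 <= theta ->
  levy_integrand (2 * l) theta <= 6 * levy_integrand l theta.
Proof.
move=> l0 t0; rewrite /levy_integrand.
have u0 : 0 <= l * theta by rewrite mulr_ge0.
have -> : - (2 * l) * theta = - (l * theta) + - (l * theta) by lra.
have -> : 2 * l * theta = l * theta + l * theta by lra.
rewrite mulNr expRD; move: (l * theta) u0 => u u0.
have hu : expR (- u) = expR (- (u / 2)) * expR (- (u / 2)).
  by rewrite -expRD; congr expR; lra.
have h1 := expR_ge1Dx (- (u / 2)); have h2 := expR_ge1Dx (- u).
have e0 := expR_gt0 (- u); have e1 : expR (- u) <= 1 by rewrite expR_le1; lra.
(* With [E = expR (- u)], [E ^+ 2 - 1 + 2 * u = (1 - E) ^+ 2 + 2 * (E - 1 + u)], whence 6 = 4 + 2.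
   For [u <= 2], [E >= (1 - u / 2) ^+ 2] makes the right-hand side at least [u ^+ 2]; for [u > 2] it
   exceeds 4, and the left-hand side is at most 1. *)
suff : (1 - expR (- u)) ^+ 2 <= 4 * (expR (- u) - 1 + u) by rewrite expr2; nra.
have [u2|u2] := leP u 2.
  have sq : (1 - expR (- u)) ^+ 2 <= u ^+ 2 by rewrite ler_sqr ?nnegrE; lra.
  apply: (le_trans sq); rewrite hu expr2; nra.
by rewrite expr2; nra.
Qed.

End levy_integrand.

Section branching_fun_properties.
Context {R : realType} (alpha beta : R).
Variable pi : {measure set (measurableTypeR R) -> \bar R}.
Hypothesis alpha0 : 0 <= alpha.
Hypothesis beta0 : 0 <= beta.
Hypothesis levy_fin :
  (\int[pi]_(theta in `]0%R, +oo[) (Num.min theta (theta ^+ 2))%:E < +oo)%E.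

Notation Phi := (branching_fun alpha beta pi).
Notation D := (`]0%R, +oo[%classic : set (measurableTypeR R)).

(** The derivative of the branching mechanism. *)
Definition branching_slope p : R :=
  alpha + 2 * beta * p + \int[pi]_(theta in D) levy_slope p theta.

Let Dge0 theta : D theta -> 0 <= theta.
Proof. by rewrite /= in_itv/= andbT => /ltW. Qed.

Let mD : measurable D. Proof. exact: measurable_itv. Qed.

Lemma measurable_levy_bound :
  measurable_fun D (fun theta : measurableTypeR R => Num.min theta (theta ^+ 2)).
Proof.
apply: measurable_minr; first by apply: measurable_id.
by apply: measurable_funX; apply: measurable_id.
Qed.

Lemma integrable_levy_bound :
  pi.-integrable D (fun theta => (Num.min theta (theta ^+ 2))%:E).
Proof.
apply/integrableP; split; first by apply/measurable_EFinP; apply: measurable_levy_bound.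
rewrite (_ : (\int[pi]_(x in D) _)%E =
  (\int[pi]_(theta in `]0%R, +oo[) (Num.min theta (theta ^+ 2))%:E)%E) //.
apply: eq_integral => x /[!inE] /Dge0 x0 /=.
by rewrite ger0_norm// le_min x0/= exprn_ge0.
Qed.

Lemma integrable_levy_dominated (h : R -> R) c : measurable_fun D h ->
  (forall theta, 0 <= theta -> 0 <= h theta <= c * Num.min theta (theta ^+ 2)) ->
  pi.-integrable D (EFin \o h).
Proof.
move=> mh hb.
have ib := @integrableZl _ _ _ pi D mD c _ integrable_levy_bound.
refine (@le_integrable _ (measurableTypeR R) R pi D mD (EFin \o h) _ _ _ ib).
- exact/measurable_EFinP.
- move=> x /Dge0 x0; have /andP[h0 hc] := hb _ x0.
  by rewrite -EFinM /= lee_fin !ger0_norm// (le_trans h0).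
Qed.

Lemma measurable_levy_exp p :
  measurable_fun D (fun theta : measurableTypeR R => expR (- p * theta)).
Proof.
apply: measurableT_comp; first exact: measurable_expR.
by apply: measurable_funM.
Qed.

Lemma integrable_levy_integrand l : 0 <= l ->
  pi.-integrable D (EFin \o levy_integrand l).
Proof.
move=> l0; apply: (@integrable_levy_dominated _ (l * Num.max 1 l)) => [|t t0].
  apply: measurable_funD; last by apply: measurable_funM.
  by apply: measurable_funB => //; exact: measurable_levy_exp.
by rewrite levy_integrand_ge0/= -mulrA levy_integrand_le.
Qed.

Lemma integrable_levy_slope p : 0 <= p ->
  pi.-integrable D (EFin \o levy_slope p).
Proof.
move=> p0; apply: (@integrable_levy_dominated _ (Num.max 1 p)) => [|t t0].
  apply: measurable_funM; first exact: measurable_id.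
  by apply: measurable_funB => //; exact: measurable_levy_exp.
by rewrite levy_slope_ge0//= levy_slope_le.
Qed.

Lemma branching_fun0 : Phi 0 = 0.
Proof.
rewrite /branching_fun mulr0 expr0n/= mulr0 !add0r /Rintegral integral0_eq//.
by move=> x _; rewrite -/(levy_integrand 0 x) levy_integrand0.
Qed.

Lemma branching_slope_nondecr q p : 0 <= q -> q <= p ->
  branching_slope q <= branching_slope p.
Proof.
move=> q0 qp; rewrite /branching_slope; apply: lerD.
  by rewrite lerD2l ler_wpM2l// mulr_ge0.
apply: le_Rintegral => //; first exact: integrable_levy_slope.
  by apply: integrable_levy_slope; exact: le_trans qp.
by move=> x /Dge0 x0; exact: levy_slope_nondecr.
Qed.

Lemma branching_slope_ge q p : 0 <= q -> q <= p ->
  alpha * (p - q) <= Phi p - Phi q.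
Proof.
move=> q0 qp; have p0 := le_trans q0 qp; rewrite /branching_fun.
have hi : \int[pi]_(t in D) levy_integrand q t <= \int[pi]_(t in D) levy_integrand p t.
  apply: le_Rintegral => //; try exact: integrable_levy_integrand.
  by move=> x /Dge0 x0; have /andP[+ _] := levy_integrand_slope q0 qp x0; rewrite subr_ge0.
have hq : beta * q ^+ 2 <= beta * p ^+ 2 by rewrite ler_wpM2l// ler_sqr.
rewrite -/(levy_integrand _); move: hi hq; rewrite /levy_integrand; lra.
Qed.

(** Convexity, integrated from [levy_integrand_slope]: a secant ending at [p] is at most as steep as
    the derivative there. *)
Lemma branching_slope_le q p : 0 <= q -> q <= p ->
  Phi p - Phi q <= branching_slope p * (p - q).
Proof.
move=> q0 qp; have p0 := le_trans q0 qp; rewrite /branching_fun /branching_slope.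
have hi : \int[pi]_(t in D) levy_integrand p t - \int[pi]_(t in D) levy_integrand q t
    <= (p - q) * \int[pi]_(t in D) levy_slope p t.
  rewrite -RintegralB//; try exact: integrable_levy_integrand.
  rewrite -RintegralZl//; last exact: integrable_levy_slope.
  apply: le_Rintegral => //.
  - have := @integrableB _ _ _ pi D mD _ _ (integrable_levy_integrand p0)
      (integrable_levy_integrand q0).
    by apply: eq_integrable.
  - have := @integrableZl _ _ _ pi D mD (p - q) _ (integrable_levy_slope p0).
    by apply: eq_integrable.
  - by move=> x /Dge0 x0; have /andP[] := levy_integrand_slope q0 qp x0.
have hq : p ^+ 2 - q ^+ 2 <= 2 * p * (p - q) by rewrite !expr2; nra.
have : beta * (p ^+ 2 - q ^+ 2) <= beta * (2 * p * (p - q)) by rewrite ler_wpM2l.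
move: hi; rewrite /levy_integrand; lra.
Qed.

Lemma branching_fun_nondecr q p : 0 <= q -> q <= p -> Phi q <= Phi p.
Proof.
move=> q0 qp; rewrite -subr_ge0; apply: le_trans (branching_slope_ge q0 qp).
by rewrite mulr_ge0// subr_ge0.
Qed.

Lemma branching_fun_double l : 0 <= l -> Phi (2 * l) <= 6 * Phi l.
Proof.
move=> l0; rewrite /branching_fun.
have hi : \int[pi]_(t in D) levy_integrand (2 * l) t
    <= 6 * \int[pi]_(t in D) levy_integrand l t.
  rewrite -RintegralZl//; last exact: integrable_levy_integrand.
  apply: le_Rintegral => //.
  - by apply: integrable_levy_integrand; rewrite mulr_ge0.
  - have := @integrableZl _ _ _ pi D mD 6 _ (integrable_levy_integrand l0).
    by apply: eq_integrable.
  - by move=> x /Dge0 x0; exact: levy_integrand_double.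
have h1 : 0 <= alpha * l by rewrite mulr_ge0.
have h2 : 0 <= beta * l ^+ 2 by rewrite mulr_ge0// exprn_ge0.
have -> : beta * (2 * l) ^+ 2 = 4 * (beta * l ^+ 2) by rewrite !expr2; lra.
move: hi; rewrite /levy_integrand; lra.
Qed.

(** Positivity is assumed beyond [lambda'] only, whereas the argument runs where the flow is close
    to 0. Iterated doubling gives [Phi (2 ^+ n * l) <= 6 ^+ n * Phi l], and for large [n] the
    left-hand side is positive. *)
Lemma branching_fun_gt0 lambda' : 0 < lambda' -> 0 < Phi lambda' ->
  forall l, 0 < l -> 0 < Phi l.
Proof.
move=> l'0 P'0 l l0.
have iter n : Phi (2 ^+ n * l) <= 6 ^+ n * Phi l.
  elim: n => [|n ih]; first by rewrite !expr0 !mul1r.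
  rewrite !exprS -!mulrA; apply: (le_trans (branching_fun_double _)).
    by rewrite mulr_ge0 ?exprn_ge0// ltW.
  by rewrite ler_pM2l.
have [n hn] : exists n : nat, lambda' / l <= 2 ^+ n.
  exists (Num.bound (lambda' / l)).
  apply: (le_trans (ltW (archi_boundP _))); first by rewrite divr_ge0// ltW.
  by rewrite -natrX ler_nat ltnW// ltn_expl.
rewrite ler_pdivrMr// in hn.
have : 0 < 6 ^+ n * Phi l.
  by apply: lt_le_trans (iter n); apply: lt_le_trans P'0 (branching_fun_nondecr (ltW l'0) hn).
by rewrite pmulr_rgt0// exprn_gt0.
Qed.

(** [alpha] is the limit of the derivative of [Phi] at 0, by dominated convergence along [p_ n]. As
    [p_ n <= 1], the constant in [levy_slope_le] is 1, and the dominating function is that of the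
    Levy condition. *)
Lemma branching_slope_near0 e : 0 < e ->
  exists2 p, 0 < p & branching_slope p <= alpha + e.
Proof.
move=> e0.
pose p_ n : R := n.+1%:R^-1.
have p0 n : 0 < p_ n by rewrite invr_gt0.
have p_cvg : p_ n @[n --> \oo] --> (0 : R) by exact: cvg_harmonic.
have ae_cvg : {ae pi, forall t, D t ->
    (levy_slope (p_ n) t)%:E @[n --> \oo] --> 0%E}.
  apply/aeW => t /Dge0 t0.
  apply/cvg_EFin; first exact: nearW.
  rewrite (_ : 0 = t * (1 - expR (- 0 * t))); last first.
    by rewrite oppr0 mul0r expR0 subrr mulr0.
  apply: cvgMr; apply: cvgB; first exact: cvg_cst.
  apply: continuous_cvg; first exact: continuous_expR.
  by apply: cvgMl; exact: cvgN.
have ae_le : {ae pi, forall t n, D t ->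
    (`|(levy_slope (p_ n) t)%:E| <= (Num.min t (t ^+ 2))%:E)%E}.
  apply/aeW => t n /Dge0 t0; rewrite abse_EFin lee_fin.
  rewrite ger0_norm; last exact: (levy_slope_ge0 (ltW (p0 n)) t0).
  have := levy_slope_le (ltW (p0 n)) t0; rewrite (_ : Num.max 1 (p_ n) = 1) ?mul1r//.
  by rewrite max_l// /p_ invf_le1// ler1n.
have Jcvg : (\int[pi]_(t in D) levy_slope (p_ n) t) @[n --> \oo] --> (0 : R).
  have [_ _] := dominated_convergence mD
    (fun n => measurable_int _ (integrable_levy_slope (ltW (p0 n))))
    (measurable_cst _) ae_cvg integrable_levy_bound ae_le.
  by rewrite integral_cst//= mul0e => /fine_cvg.
have Lcvg : branching_slope (p_ n) @[n --> \oo] --> (alpha : R).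
  rewrite /branching_slope -[X in _ --> X]addr0; apply: cvgD; last exact: Jcvg.
  rewrite -[X in _ --> X]addr0; apply: cvgD; first exact: cvg_cst.
  by rewrite -[X in _ --> X](mulr0 (2 * beta)); exact: cvgMr.
have /cvgrPdist_le /(_ _ e0) [N _ /(_ N (leqnn N)) /=] := Lcvg.
by rewrite distrC ler_distl => /andP[_ h]; exists (p_ N).
Qed.

End branching_fun_properties.

(** * The flow of the branching mechanism *)

Section real_functions.
Context {R : realType}.
Implicit Types (f df : R -> R) (k a b x : R).

Lemma lipschitz_within_continuous f k a b :
  (forall x y, a <= x <= b -> a <= y <= b -> `|f x - f y| <= k * `|x - y|) ->
  {within `[a, b], continuous f}.
Proof.
move=> fk; have k1 : 0 < `|k| + 1 by rewrite ltr_wpDl.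
apply/subspace_continuousP => x /= /[!in_itv]/= xab.
apply/cvgrPdist_le => e e0; rewrite near_withinE.
have ek : 0 < e / (`|k| + 1) by rewrite divr_gt0.
near=> y; rewrite /= in_itv/= => yab.
apply: (le_trans (fk _ _ xab yab)).
have xy : `|x - y| <= e / (`|k| + 1) by near: y; exact: cvgr_dist_le.
apply: (@le_trans _ _ ((`|k| + 1) * `|x - y|)).
  by rewrite ler_wpM2r// (le_trans (ler_norm k))// lerDl.
by rewrite mulrC -ler_pdivlMr.
Unshelve. all: by end_near. Qed.

Lemma lipschitz_continuous_at f k a b x : a < x < b ->
  (forall x y, a <= x <= b -> a <= y <= b -> `|f x - f y| <= k * `|x - y|) ->
  {for x, continuous f}.
Proof.
move=> /andP[ax xb] fk; have ab := lt_trans ax xb.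
have /(continuous_within_itvP _ ab)[+ _ _] := lipschitz_within_continuous fk.
by move=> h; apply: h; rewrite in_itv/= ax xb.
Qed.

Lemma is_derive_nonincreasing f df a b : a <= b ->
  (forall x, a < x < b -> is_derive x 1 f (df x)) ->
  (forall x, a < x < b -> df x <= 0) ->
  {within `[a, b], continuous f} -> f b <= f a.
Proof.
move=> ab fdf df0 cf; apply: (@ler0_derive1_le_cc R f a b) => //.
- by move=> x; rewrite in_itv/= => xab; have [] := fdf _ xab.
- move=> x; rewrite in_itv/= => xab; rewrite derive1E.
  by have [_ ->] := fdf _ xab; exact: df0.
- by rewrite in_itv/= lexx ab.
- by rewrite in_itv/= lexx ab.
Qed.

End real_functions.

Section flow.
Context {R : realType} (Phi : R -> R).

(** The equation is imposed for [t > 0] only; the Lipschitz clause supplies the continuity up to 0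
    that monotonicity arguments on [[0, T]] require. *)
Record is_flow (u : R -> R) : Prop := IsFlow {
  flow_ge0 : forall t : R, 0 <= t -> 0 <= u t ;
  flow_lipschitz : exists k, forall s t : R, 0 <= s -> 0 <= t ->
    `|u s - u t| <= k * `|s - t| ;
  flow_derive : forall t : R, 0 < t -> is_derive t 1 u (- Phi (u t)) }.

Lemma flow_shift (u : R -> R) a : 0 <= a -> is_flow u ->
  is_flow (fun s => u (a + s)).
Proof.
move=> a0 [u0 [k uk] du]; split.
- by move=> t t0; rewrite u0// addr_ge0.
- exists k => s t s0 t0; apply: (le_trans (uk _ _ _ _)); rewrite ?addr_ge0//.
  by rewrite opprD addrACA subrr add0r.
- move=> t t0.
  have at0 : 0 < a + t by rewrite ltr_wpDl.
  have d1 : is_derive t 1 (fun s : R => a + s) 1.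
    by rewrite -[X in is_derive _ _ _ X]add0r; apply: is_deriveD.
  have := @is_derive1_comp R u (fun s : R => a + s) t _ _ (du _ at0) d1.
  by rewrite mulr1.
Qed.

Lemma flow_continuous u (a b : R) : is_flow u -> 0 <= a ->
  {within `[a, b], continuous u}.
Proof.
move=> [_ [k uk] _] a0; apply: (@lipschitz_within_continuous _ _ k) => x y /andP[ax _] /andP[ay _].
by apply: uk; [exact: le_trans ax|exact: le_trans ay].
Qed.

(** The product of [u - w] with [expR (c * s)] has nonpositive derivative. For [w <= u] the
    hypothesis bounds slopes of [Phi] from below by [c], for [u <= w] from above; both readings are
    used. *)
Lemma flow_gronwall (u w : R -> R) (c T : R) : is_flow u -> is_flow w -> 0 <= T ->
  (forall s, 0 < s < T -> c * (u s - w s) <= Phi (u s) - Phi (w s)) ->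
  (u T - w T) * expR (c * T) <= u 0 - w 0.
Proof.
move=> fu fw T0 h.
have -> : u 0 - w 0 = (u 0 - w 0) * expR (c * 0) by rewrite mulr0 expR0 mulr1.
pose f := (u - w) * (fun s : R => expR (c * s)).
pose df s := (u s - w s) * (expR (c * s) * c)
             + expR (c * s) * (- Phi (u s) - - Phi (w s)).
apply: (@is_derive_nonincreasing _ f df 0 T T0).
- move=> x /andP[x0 xT].
  have du := flow_derive fu x0; have dw := flow_derive fw x0.
  have d1 : is_derive x 1 (fun s : R => c * s) c.
    by rewrite -[X in is_derive _ _ _ X]mulr1; apply: is_deriveZ.
  have de := @is_derive1_comp R expR (fun s : R => c * s) x _ _
               (is_derive_expR _) d1.
  refine (is_derive_eq (is_deriveM (is_deriveB du dw) de) _).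
  by [].
- move=> x xT; have := h _ xT; have := expR_gt0 (c * x); rewrite /df; nra.
- move=> x; apply: cvgM; first apply: cvgB.
  + exact: flow_continuous.
  + exact: flow_continuous.
  + apply: continuous_subspaceT => y; apply: continuous_comp.
      exact: mulrl_continuous.
    exact: continuous_expR.
Qed.

(** Monotonicity of [Phi] makes [(u - w) ^+ 2] nonincreasing. This yields uniqueness, hence the
    semigroup property, and continuity in the initial value. *)
Lemma flow_contraction (u w : R -> R) (T : R) :
  {in Num.nneg &, {homo Phi : x y / x <= y}} ->
  is_flow u -> is_flow w -> 0 <= T -> `|u T - w T| <= `|u 0 - w 0|.
Proof.
move=> Phi_nd fu fw T0; rewrite -ler_sqr ?nnegrE// !real_normK ?num_real//.
pose f := (u - w) * (u - w).
pose df s := (u s - w s) * (- Phi (u s) - - Phi (w s))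
             + (u s - w s) * (- Phi (u s) - - Phi (w s)).
have -> : (u T - w T) ^+ 2 = f T by rewrite expr2.
have -> : (u 0 - w 0) ^+ 2 = f 0 by rewrite expr2.
apply: (@is_derive_nonincreasing _ f df 0 T T0).
- move=> x /andP[x0 xT].
  have db := is_deriveB (flow_derive fu x0) (flow_derive fw x0).
  by refine (is_derive_eq (is_deriveM db db) _).
- move=> x /andP[/ltW x0 xT]; rewrite /df.
  have u0 := flow_ge0 fu x0; have w0 := flow_ge0 fw x0.
  have [uw|/ltW uw] := leP (u x) (w x).
    by have := Phi_nd _ _ _ _ uw; rewrite !nnegrE u0 w0 => /(_ isT isT); nra.
  by have := Phi_nd _ _ _ _ uw; rewrite !nnegrE u0 w0 => /(_ isT isT); nra.
- by move=> x; apply: cvgM; apply: cvgB; exact: flow_continuous.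
Qed.

Lemma flow_decay (u : R -> R) (m a b : R) : is_flow u -> 0 <= a -> a <= b ->
  (forall s, a < s < b -> m <= Phi (u s)) ->
  m * (b - a) <= u a - u b.
Proof.
move=> fu a0 ab h.
pose f := u + (fun s : R => m * s).
suff : u b + m * b <= u a + m * a by lra.
rewrite -[leLHS]/(f b) -[leRHS]/(f a).
apply: (@is_derive_nonincreasing _ f (fun s => - Phi (u s) + m) a b ab).
- move=> x /andP[ax xb].
  have d1 : is_derive x 1 (fun s : R => m * s) m.
    by rewrite -[X in is_derive _ _ _ X]mulr1; apply: is_deriveZ.
  exact: is_deriveD (flow_derive fu (le_lt_trans a0 ax)) d1.
- by move=> x /h /=; lra.
- move=> x; apply: cvgD; first exact: flow_continuous.
  by apply: continuous_subspaceT => y; exact: mulrl_continuous.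
Qed.

End flow.

(** * The cumulant equation as a differential equation *)

Section cumulant.
Context {R : realType}.

(** [Lam] stands for the derivative of the convex function [Phi], and [alpha] for
    its right derivative at [0]. *)
Record slope_bounds (alpha : R) (Lam Phi : R -> R) : Prop := SlopeBounds {
  slope_alpha_ge0 : 0 <= alpha ;
  slope_zero : Phi 0 = 0 ;
  slope_ge : forall q p, 0 <= q -> q <= p -> alpha * (p - q) <= Phi p - Phi q ;
  slope_le : forall q p, 0 <= q -> q <= p -> Phi p - Phi q <= Lam p * (p - q) ;
  slope_nondecr : forall q p, 0 <= q -> q <= p -> Lam q <= Lam p }.

Context (alpha : R) (Lam Phi : R -> R).
Hypothesis PhiS : slope_bounds alpha Lam Phi.

Lemma slope_homo q p : 0 <= q -> q <= p -> Phi q <= Phi p.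
Proof.
move=> q0 qp; rewrite -subr_ge0; apply: le_trans (slope_ge PhiS q0 qp).
by rewrite mulr_ge0 ?subr_ge0// (slope_alpha_ge0 PhiS).
Qed.

Lemma slope_fun_ge0 p : 0 <= p -> 0 <= Phi p.
Proof. by move=> p0; rewrite -(slope_zero PhiS) slope_homo. Qed.

Lemma slope_lipschitz M p q : 0 <= p <= M -> 0 <= q <= M ->
  `|Phi p - Phi q| <= Lam M * `|p - q|.
Proof.
wlog qp : p q / q <= p => [h|] pM qM.
  have [qp|/ltW pq] := leP q p; first exact: h.
  by rewrite distrC (distrC p); exact: h.
move: pM qM => /andP[p0 pM] /andP[q0 _].
rewrite ger0_norm ?subr_ge0 ?slope_homo// ger0_norm ?subr_ge0//.
apply: (le_trans (slope_le PhiS q0 qp)).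
by rewrite ler_wpM2r ?subr_ge0// (slope_nondecr PhiS).
Qed.

Lemma slope_continuous_at p : 0 < p -> {for p, continuous Phi}.
Proof.
move=> p0; apply: (@lipschitz_continuous_at _ _ (Lam (p + 1)) 0 (p + 1)).
  by rewrite p0 ltrDl ltr01.
by move=> x y; exact: slope_lipschitz.
Qed.

Lemma cumulant_solution0 l u : cumulant_solution Phi l u -> u 0 = l.
Proof.
by case=> _ _ _ /(_ 0 (lexx _)) ->; rewrite set_itv1 Rintegral_set1 subr0.
Qed.

Lemma measurable_slope_comp (T : R) (u : R -> R) :
  measurable_fun (`[0, +oo[ : set R) u -> (forall t, 0 <= t -> 0 <= u t) ->
  measurable_fun (`[0, T] : set R) (Phi \o u).
Proof.
move=> mu u0.
have sub : (`[0, T] : set R) `<=` `[0, +oo[ by exact: subset_itvl.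
(* [Phi] is known to be monotone on [[0, +oo[]; composing it with [Num.max 0] gives a function
   monotone on the whole line, hence Borel. *)
have mP : measurable_fun setT (fun y : R => Phi (Num.max 0 y)).
  apply: nondecreasing_measurable => // a b ab; apply: slope_homo.
    by rewrite le_max lexx.
  by rewrite ge_max le_max lexx/= le_max ab orbT.
apply: (@eq_measurable_fun _ _ _ _ _ (fun t => Phi (Num.max 0 (u t)))).
  move=> t /[!inE]/= /[!in_itv]/= /andP[t0 _].
  by rewrite max_r// u0.
apply: (measurableT_comp mP); apply: measurable_funS mu => //.
Qed.

Lemma integrable_slope_comp l (T : R) (u : R -> R) : cumulant_solution Phi l u -> 0 <= T ->
  lebesgue_measure.-integrable `[0, T] (EFin \o (Phi \o u)).
Proof.
move=> [mu u0 ub _] T0; have [M uM] := ub _ T0.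
apply: measurable_bounded_integrable => //.
- by rewrite /= lebesgue_measure_itv/=; case: ifPn => // _; rewrite -EFinB ltry.
- exact: measurable_slope_comp.
- exists (Phi M); split; first exact: num_real.
  move=> y My t /= /[!in_itv]/= tT.
  have ut0 : 0 <= u t by rewrite u0//; case/andP : tT.
  rewrite ger0_norm ?slope_fun_ge0//.
  by apply: le_trans (ltW My); apply: slope_homo => //; exact: uM.
Qed.

Lemma cumulant_increment l (u : R -> R) (s t : R) : cumulant_solution Phi l u ->
  0 <= s -> s <= t -> u s - u t = \int[lebesgue_measure]_(r in `]s, t]) Phi (u r).
Proof.
move=> ul s0 st; have t0 := le_trans s0 st.
rewrite (cumulant_eq ul s0) (cumulant_eq ul t0).
rewrite -(@Rintegral_itvB _ (Phi \o u) (BLeft 0) (BRight t) s) ?bnd_simp//; last first.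
  exact: (integrable_slope_comp ul).
rewrite /=; lra.
Qed.

Lemma cumulant_le l (u : R -> R) (t : R) : cumulant_solution Phi l u -> 0 <= t ->
  u t <= l.
Proof.
move=> ul t0; rewrite -(cumulant_solution0 ul) -subr_ge0 (cumulant_increment ul)//.
apply: Rintegral_ge0 => x /= /[!in_itv]/= /andP[/ltW x0 _].
by rewrite slope_fun_ge0// (cumulant_ge0 ul).
Qed.

(** Since [0 <= Phi (u s) <= Phi l], the integral equation makes [u] Lipschitz with constant
    [Phi l]. Then [Phi \o u] is continuous at positive times and the integral can be differentiated
    there. *)
Lemma cumulant_flow l u : cumulant_solution Phi l u -> is_flow Phi u.
Proof.
move=> ul.
have l0 : 0 <= l by rewrite -(cumulant_solution0 ul) (cumulant_ge0 ul).
have ulip s t : 0 <= s -> 0 <= t -> `|u s - u t| <= Phi l * `|s - t|.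
  wlog st : s t / s <= t => [h|] s0 t0.
    have [st|/ltW ts] := leP s t; first exact: h.
    by rewrite distrC (distrC s); exact: h.
  have sub : (`]s, t] : set R) `<=` `[0, t].
    by apply: subset_itvr; rewrite bnd_simp.
  have intu : lebesgue_measure.-integrable `]s, t] (EFin \o (Phi \o u)).
    exact: integrableS (integrable_slope_comp ul t0).
  have Phi0 x : `]s, t]%classic x -> 0 <= Phi (u x) <= Phi l.
    move=> /= /[!in_itv]/= /andP[/ltW sx _]; have x0 := le_trans s0 sx.
    have ux0 := cumulant_ge0 ul x0.
    by rewrite slope_fun_ge0//= slope_homo// (cumulant_le ul).
  rewrite (distrC s) (ger0_norm (_ : 0 <= t - s)) ?subr_ge0//.
  rewrite (cumulant_increment ul)// ger0_norm; last first.
    by apply: Rintegral_ge0 => x /Phi0/andP[].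
  have -> : Phi l * (t - s) = \int[lebesgue_measure]_(r in `]s, t]) Phi l.
    rewrite Rintegral_cst//= lebesgue_measure_itv/= lte_fin.
    by move: st; rewrite le_eqVlt => /predU1P[->|->]//; rewrite ltxx subrr.
  apply: le_Rintegral => //; last by move=> x /Phi0/andP[].
  apply: measurable_bounded_integrable => //; last exact: bounded_cst.
  by rewrite /= lebesgue_measure_itv/=; case: ifPn => // _; rewrite -EFinB ltry.
split; [exact: (cumulant_ge0 ul)|by exists (Phi l)|move=> t t0].
have ct : {for t, continuous (Phi \o u)}.
  apply: (@lipschitz_continuous_at _ _ (`|Lam l| * Phi l) 0 (t + 1)).
    by rewrite t0 ltrDl ltr01.
  move=> x y /andP[x0 _] /andP[y0 _]; rewrite /=.
  have ux := cumulant_ge0 ul x0; have uy := cumulant_ge0 ul y0.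
  have ux' := cumulant_le ul x0; have uy' := cumulant_le ul y0.
  apply: (le_trans (@slope_lipschitz l _ _ _ _)); rewrite ?ux ?uy//.
  apply: (le_trans (ler_wpM2r (normr_ge0 _) (ler_norm _))).
  by rewrite -mulrA ler_wpM2l// ulip.
have t1 : t < t + 1 by rewrite ltrDl.
have [dF F'] := @continuous_FTC1_closed _ (Phi \o u) 0 t (t + 1) t1
   (integrable_slope_comp ul (ltW (lt_trans t0 t1))) t0 ct.
pose G s : R := \int[lebesgue_measure]_(r in `[0, s]) (Phi \o u) r.
have dG : is_derive t 1 G (Phi (u t)) by split=> //; rewrite -derive1E F'.
have dlG : is_derive t 1 (cst l - G) (- Phi (u t)).
  by rewrite -[X in is_derive _ _ _ X]add0r; apply: is_deriveB.
refine (near_eq_is_derive _ dlG).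
near=> s; rewrite (cumulant_eq ul)//; near: s.
by apply: filterS (lt_nbhsr t0) => x /ltW.
Unshelve. all: by end_near. Qed.

End cumulant.

(** * Grey's condition and uniform bounds for the flow *)

Section grey.
Context {R : realType} (alpha : R) (Lam Phi : R -> R) (lambda' : R).
Hypothesis PhiS : slope_bounds alpha Lam Phi.
Hypothesis lambda'0 : 0 < lambda'.
Hypothesis Phi_gt0 : forall l, 0 < l -> 0 < Phi l.
Hypothesis grey :
  (\int[lebesgue_measure]_(l in `[lambda', +oo[) ((Phi l)^-1)%:E < +oo)%E.

Let mu := @lebesgue_measure R.

Let measurable_inv : measurable_fun (`[lambda', +oo[ : set R) (fun l => (Phi l)^-1).
Proof.
have mP : measurable_fun setT (fun y : R => - (Phi (Num.max lambda' y))^-1).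
  apply: nondecreasing_measurable => // a b ab.
  have a0 : 0 < Num.max lambda' a by rewrite lt_max lambda'0.
  have b0 : 0 < Num.max lambda' b by rewrite lt_max lambda'0.
  rewrite lerN2 lef_pV2 ?posrE ?Phi_gt0//; apply: (slope_homo PhiS) => //.
    exact: ltW.
  by rewrite ge_max le_max lexx/= le_max ab orbT.
apply: (@eq_measurable_fun _ _ _ _ _
    (fun y : R => - - (Phi (Num.max lambda' y))^-1)).
  by move=> t /[!inE]/= /[!in_itv]/= /andP[t0 _]; rewrite max_r// opprK.
by apply: measurable_funTS; exact: measurable_funN.
Qed.

Let integrable_inv :
  mu.-integrable `[lambda', +oo[ (fun l => ((Phi l)^-1)%:E).
Proof.
apply/integrableP; split; first exact/measurable_EFinP.
rewrite (_ : integral _ _ _ =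
  (\int[lebesgue_measure]_(l in `[lambda', +oo[) ((Phi l)^-1)%:E)%E)//.
apply: eq_integral => x /[!inE]/= /[!in_itv]/= /andP[lx _].
by rewrite ger0_norm// invr_ge0 ltW// Phi_gt0// (lt_le_trans lambda'0).
Qed.

Let K y := \int[mu]_(l in `[lambda', y]) (Phi l)^-1.

Let integrable_inv_itv y :
  mu.-integrable `[lambda', y] (fun l => ((Phi l)^-1)%:E).
Proof. by apply: integrableS integrable_inv => //; exact: subset_itvl. Qed.

Let K_increment a b : lambda' <= a -> a <= b ->
  K b - K a = \int[mu]_(l in `]a, b]) (Phi l)^-1.
Proof.
move=> la ab; rewrite /K.
by rewrite (@Rintegral_itvB _ _ (BLeft lambda') (BRight b) a)// integrable_inv_itv.
Qed.

Let K_lip a b : lambda' <= a -> a <= b -> 0 <= K b - K a <= (Phi lambda')^-1 * (b - a).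
Proof.
move=> la ab; rewrite K_increment//.
have bnd x : `]a, b]%classic x -> 0 <= (Phi x)^-1 <= (Phi lambda')^-1.
  move=> /= /[!in_itv]/= /andP[/ltW ax _]; have lx := le_trans la ax.
  have x0 := lt_le_trans lambda'0 lx.
  rewrite invr_ge0 (ltW (Phi_gt0 x0))/= lef_pV2 ?posrE ?Phi_gt0//.
  by apply: (slope_homo PhiS) => //; exact: ltW.
apply/andP; split; first by apply: Rintegral_ge0 => x /bnd/andP[].
have -> : (Phi lambda')^-1 * (b - a) = \int[mu]_(r in `]a, b]) (Phi lambda')^-1.
  rewrite Rintegral_cst//= /mu lebesgue_measure_itv/= lte_fin.
  by move: ab; rewrite le_eqVlt => /predU1P[->|->]//; rewrite ltxx subrr.
apply: le_Rintegral => //; last by move=> x /bnd/andP[].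
- apply: integrableS (integrable_inv_itv b) => //.
  by apply: subset_itvr; rewrite bnd_simp.
- apply: measurable_bounded_integrable => //; last exact: bounded_cst.
  by rewrite /= /mu lebesgue_measure_itv/=; case: ifPn => // _; rewrite -EFinB ltry.
Qed.

Let K_le y : K y <= \int[mu]_(l in `[lambda', +oo[) (Phi l)^-1.
Proof.
rewrite /K /Rintegral fine_le//; try exact: integrable_fin_num.
apply: ge0_subset_integral => //; last exact: subset_itvl.
  exact/measurable_EFinP.
move=> x /= /[!in_itv]/= /andP[lx _].
by rewrite lee_fin invr_ge0 ltW// Phi_gt0// (lt_le_trans lambda'0).
Qed.

Let K_derive y : lambda' < y -> is_derive y 1 K (Phi y)^-1.
Proof.
move=> ly; have y1 : y < y + 1 by rewrite ltrDl.
have cy : {for y, continuous (fun l => (Phi l)^-1)}.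
  have y0 := lt_trans lambda'0 ly.
  apply: cvgV; first by rewrite gt_eqF// Phi_gt0.
  exact: (slope_continuous_at PhiS).
have [dK K'] := @continuous_FTC1_closed _ (fun l => (Phi l)^-1) lambda' y (y + 1) y1
  (integrable_inv_itv _) ly cy.
by split; [exact: dK|rewrite -derive1E; exact: K'].
Qed.

(** Along the flow, [K (u t)] decreases at unit speed, while [K] is bounded. *)
Lemma grey_flow_bounded t : 0 < t ->
  exists M, forall u, is_flow Phi u -> u t <= M.
Proof.
move=> t0; pose S := [set K y | y in `[lambda', +oo[].
have supS : has_sup S.
  split; first by exists (K lambda'), lambda' => //=; rewrite in_itv/= lexx.
  by exists (\int[mu]_(l in `[lambda', +oo[) (Phi l)^-1) => _ [y _ <-]; exact: K_le.
(* [M] is chosen with [sup S - t < K M], independently of the flow. A flow above [M] at time [t] is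
   above [lambda'] on all of [[0, t]], and [K (u 0)] would exceed [sup S]. *)
have [_ [M + <-] KM] := sup_adherent t0 supS.
rewrite /= in_itv/= andbT => lM.
exists M => u fu; rewrite leNgt; apply/negP => Mu.
have ule s : 0 <= s -> s <= t -> u t <= u s.
  move=> s0 st; have := @flow_decay _ _ _ 0 s t fu s0 st.
  rewrite mul0r subr_ge0; apply => r /andP[sr _].
  by apply: (slope_fun_ge0 PhiS); apply: (flow_ge0 fu); rewrite (le_trans s0)// ltW.
have lu s : 0 <= s -> s <= t -> lambda' < u s.
  by move=> s0 st; apply: (le_lt_trans lM); apply: lt_le_trans Mu _; exact: ule.
pose f := (K \o u) + (@idfun R).
have ft0 : f t <= f 0.
  apply: (@is_derive_nonincreasing _ f
      (fun s => (Phi (u s))^-1 * - Phi (u s) + 1) 0 t (ltW t0)).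
  - move=> s /andP[s0 st].
    have dK := K_derive (lu _ (ltW s0) (ltW st)).
    have du := flow_derive fu s0.
    have dKu := @is_derive1_comp R K u s _ _ dK du.
    exact: is_deriveD dKu (is_derive_id _ _).
  - move=> s /andP[s0 st]; have us := lt_trans lambda'0 (lu _ (ltW s0) (ltW st)).
    by rewrite mulrN mulVf ?gt_eqF ?Phi_gt0// addNr.
  - have [k uk] := flow_lipschitz fu.
    suff cK : {within `[0, t], continuous (K \o u)}.
      move=> x; apply: cvgD; first exact: cK.
      by apply: continuous_subspaceT => y; exact: cvg_id.
    apply: (@lipschitz_within_continuous _ _ ((Phi lambda')^-1 * k)).
    move=> x y /andP[x0 xt] /andP[y0 yt].
    wlog uyx : x y x0 xt y0 yt / u y <= u x => [h|].
      have [uyx|/ltW uxy] := leP (u y) (u x); first exact: h.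
      by rewrite distrC (distrC x); exact: h.
    have /andP[h1 h2] := K_lip (ltW (lu _ y0 yt)) uyx.
    rewrite /= ger0_norm// (le_trans h2)// -mulrA ler_wpM2l//.
      by rewrite invr_ge0 ltW// Phi_gt0.
    by rewrite (le_trans (ler_norm _))// uk.
have Kut : K M <= K (u t).
  by have /andP[+ _] := K_lip lM (ltW Mu); rewrite subr_ge0.
have Ku0 : K (u 0) <= sup S.
  apply: sup_upper_bound => //; exists (u 0) => //=; rewrite in_itv/= andbT.
  by rewrite ltW// lu// ltW.
move: ft0; rewrite /f; change (K (u t) + t <= K (u 0) + 0 -> False).
lra.
Qed.

End grey.

(** * The extinction rate *)

Section extinction_rate.
Context {R : realType} (alpha : R) (Lam Phi : R -> R) (v : R -> R -> R).
Hypothesis PhiS : slope_bounds alpha Lam Phi.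
Hypothesis Phi_gt0 : forall l, 0 < l -> 0 < Phi l.
Hypothesis flow_bounded : forall t, 0 < t ->
  exists M, forall u, is_flow Phi u -> u t <= M.
Hypothesis v_sol : forall l, 0 <= l -> cumulant_solution Phi l (v ^~ l).
Hypothesis v_homo : forall t p q, 0 <= t -> 0 <= q -> q <= p -> v t q <= v t p.

(** The quantity written [v_t] with a bar in the paper, for [t > 0]. *)
Definition extinction_rate t : R := limn (fun n => v t n%:R).

Let v_flow l : 0 <= l -> is_flow Phi (v ^~ l).
Proof. by move=> l0; exact: (cumulant_flow PhiS (v_sol l0)). Qed.

Let v0 l : 0 <= l -> v 0 l = l.
Proof. by move=> l0; exact: cumulant_solution0 (v_sol l0). Qed.

Let v_ge0 t l : 0 <= t -> 0 <= l -> 0 <= v t l.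
Proof. by move=> t0 l0; exact: flow_ge0 (v_flow l0) _ t0. Qed.

(** Gronwall's lemma run backwards: the gap [p - q] shrinks at a rate of at most [Lam p], since the
    trajectory from [p] stays below [p]. Putting the smaller solution first in [flow_gronwall]
    reverses its inequality. *)
Lemma cumulant_gronwall T p q : 0 <= T -> 0 <= q -> q <= p ->
  p - q <= (v T p - v T q) * expR (Lam p * T).
Proof.
move=> T0 q0 qp; have p0 := le_trans q0 qp.
have := @flow_gronwall R Phi (v ^~ q) (v ^~ p) (Lam p) T (v_flow q0) (v_flow p0) T0.
rewrite !v0// => h; have {}h : (v T q - v T p) * expR (Lam p * T) <= q - p.
  apply: h => s /andP[/ltW s0 _].
  have vp := v_ge0 s0 p0; have vq := v_ge0 s0 q0; have vqp := v_homo s0 q0 qp.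
  have h1 := slope_le PhiS vq vqp.
  have vpp : v s p <= p := cumulant_le PhiS (v_sol p0) s0.
  have h2 := slope_nondecr PhiS vp vpp.
  have : Lam (v s p) * (v s p - v s q) <= Lam p * (v s p - v s q).
    by rewrite ler_wpM2r// subr_ge0.
  lra.
have : (v T p - v T q) * expR (Lam p * T) = - ((v T q - v T p) * expR (Lam p * T)) by lra.
lra.
Qed.

(** Gronwall's lemma against the zero solution, with [alpha] as lower bound for the slopes. *)
Lemma cumulant_le_exp t l : 0 <= t -> 0 <= l -> v t l <= l * expR (- alpha * t).
Proof.
move=> t0 l0.
have flow0 : is_flow Phi (cst 0).
  split => //.
    by exists 0 => s r _ _; rewrite subrr normr0 mul0r.
  by move=> s _; rewrite (slope_zero PhiS) oppr0; exact: is_derive_cst.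
have := @flow_gronwall R Phi (v ^~ l) (cst 0) alpha t (v_flow l0) flow0 t0.
rewrite /= v0// !subr0 => h; rewrite mulNr expRN -ler_pdivrMr ?invr_gt0 ?expR_gt0// invrK.
apply: h => s /andP[/ltW s0 _].
have := slope_ge PhiS (lexx 0) (v_ge0 s0 l0); rewrite !subr0; lra.
Qed.

(** The shifted flow and the flow restarted from [v a l] have the same initial value, so the
    contraction identifies them. *)
Lemma cumulant_semigroup a s l : 0 <= a -> 0 <= s -> 0 <= l ->
  v (a + s) l = v s (v a l).
Proof.
move=> a0 s0 l0; have va := v_ge0 a0 l0.
have PhiH : {in Num.nneg &, {homo Phi : x y / x <= y}}.
  by move=> x y; rewrite !nnegrE => x0 y0; exact: (slope_homo PhiS).
have := flow_contraction PhiH (flow_shift a0 (v_flow l0)) (v_flow va) s0.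
by rewrite /= addr0 v0// subrr normr0 normr_le0 subr_eq0 => /eqP.
Qed.

Let v_lip s p q : 0 <= s -> 0 <= p -> 0 <= q -> `|v s p - v s q| <= `|p - q|.
Proof.
move=> s0 p0 q0.
have PhiH : {in Num.nneg &, {homo Phi : x y / x <= y}}.
  by move=> x y; rewrite !nnegrE => x0 y0; exact: (slope_homo PhiS).
by have := flow_contraction PhiH (v_flow p0) (v_flow q0) s0; rewrite !v0.
Qed.

Lemma cvg_extinction_rate t : 0 < t -> v t n%:R @[n --> \oo] --> extinction_rate t.
Proof.
move=> t0; have [M hM] := flow_bounded t0.
apply: nondecreasing_is_cvgn.
  by move=> m n mn; apply: v_homo; rewrite ?ler_nat// ltW.
by exists M => _ [n _ <-]; exact: hM (v_flow (ler0n _ n)).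
Qed.

Lemma extinction_rate_ge t l : 0 < t -> 0 <= l -> v t l <= extinction_rate t.
Proof.
move=> t0 l0; apply: limr_ge; first by apply/cvg_ex; eexists; exact: cvg_extinction_rate.
near=> n; apply: v_homo => //; first exact: ltW.
by near: n; exact: nbhs_infty_ger.
Unshelve. all: by end_near. Qed.

(** [v t 0 = 0], and [cumulant_gronwall] keeps [v t 1] apart from it. *)
Lemma extinction_rate_gt0 t : 0 < t -> 0 < extinction_rate t.
Proof.
move=> t0; apply: (@lt_le_trans _ _ (v t 1)); last exact: extinction_rate_ge.
have := cumulant_gronwall (ltW t0) (lexx 0) ler01.
have -> : v t 0 = 0.
  apply/eqP; rewrite eq_le v_ge0 ?(ltW t0)// andbT.
  by have := cumulant_le_exp (ltW t0) (lexx 0); rewrite mul0r.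
rewrite !subr0 => h; have e0 := expR_gt0 (Lam 1 * t).
by rewrite -(pmulr_lgt0 _ e0) (lt_le_trans ltr01).
Qed.

(** The semigroup identity passes to the limit because [v s] is 1-Lipschitz in the initial value. *)
Lemma extinction_rate_shift a s : 0 < a -> 0 <= s ->
  extinction_rate (a + s) = v s (extinction_rate a).
Proof.
move=> a0 s0; have as0 : 0 < a + s by rewrite ltr_wpDr.
have ra0 := ltW (extinction_rate_gt0 a0).
apply: (cvg_unique _ (cvg_extinction_rate as0)) => //.
apply/cvgrPdist_le => e e0.
have /cvgrPdist_le/(_ _ e0) := cvg_extinction_rate a0.
apply: filterS => n; apply: le_trans.
by rewrite cumulant_semigroup// ?(ltW a0)// v_lip// v_ge0// ltW.
Qed.

Lemma extinction_rate_nonincr a b : 0 < a -> a <= b ->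
  extinction_rate b <= extinction_rate a.
Proof.
move=> a0 ab; have -> : b = a + (b - a) by lra.
rewrite extinction_rate_shift ?subr_ge0//.
by apply: (cumulant_le PhiS (v_sol _)); rewrite ?subr_ge0// ltW// extinction_rate_gt0.
Qed.

Lemma extinction_rate_decay a b : 0 < a -> a <= b ->
  Phi (extinction_rate b) * (b - a) <= extinction_rate a - extinction_rate b.
Proof.
move=> a0 ab; have ra0 := ltW (extinction_rate_gt0 a0).
have ba0 : 0 <= b - a by rewrite subr_ge0.
have := @flow_decay R Phi (v ^~ (extinction_rate a)) (Phi (extinction_rate b)) 0 (b - a)
  (v_flow ra0) (lexx _) ba0.
rewrite v0// -extinction_rate_shift// subr0 subrKC; apply => s /andP[s0 sb].
rewrite -extinction_rate_shift ?(ltW s0)//; apply: (slope_homo PhiS).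
  by rewrite ltW// extinction_rate_gt0// (lt_le_trans a0).
by apply: extinction_rate_nonincr; lra.
Qed.

(** While the rate exceeds [e] it decreases at speed at least [Phi e]; starting from its value at
    time 1, it cannot do so for longer than [extinction_rate 1 / Phi e]. *)
Lemma extinction_rate_cvg0 e : 0 < e -> exists2 r0, 0 < r0 &
  forall r, r0 <= r -> extinction_rate r <= e.
Proof.
move=> e0; have Pe := Phi_gt0 e0.
exists (1 + extinction_rate 1 / Phi e); first by rewrite ltr_pwDl// divr_ge0 ?ltW// extinction_rate_gt0.
move=> r hr; rewrite leNgt; apply/negP => er.
have r1 : 1 <= r by apply: le_trans hr; rewrite lerDl divr_ge0 ?ltW// extinction_rate_gt0.
have h := extinction_rate_decay ltr01 r1.
have Per : Phi e <= Phi (extinction_rate r) by apply: (slope_homo PhiS); exact: ltW.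
have : Phi e * (r - 1) <= Phi (extinction_rate r) * (r - 1) by rewrite ler_wpM2r// subr_ge0.
have : extinction_rate 1 <= Phi e * (r - 1).
  by rewrite mulrC -ler_pdivrMr// lerBrDl.
lra.
Qed.

End extinction_rate.

(** * Measure theory *)

Section integral_off_null_set.
Context d (T : measurableType d) (R : realType).
Variable mu : {measure set T -> \bar R}.

Import HBNNSimple.

(** The integral of a nonnegative function is a supremum over simple functions,
    and these may be cut off on [N]; the integrands involving the extinction
    time are not measurable. *)
Lemma eq_integral_off_null (N : set T) (f g : T -> \bar R) :
  measurable N -> mu N = 0%E -> (forall w, ~ N w -> f w = g w) ->
  (\int[mu]_w f w = \int[mu]_w g w)%E.
Proof.
move=> mN N0 fg.
have mNC : measurable (~` N) by exact: measurableC.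
have le_sup (a b : T -> \bar R) : (forall w, ~ N w -> a w = b w) ->
    (forall w, 0 <= b w)%E ->
    (ereal_sup [set sintegral mu h | h in
       [set h : {nnsfun T >-> R} | forall x, (h x)%:E <= a x]]
    <= ereal_sup [set sintegral mu h | h in
       [set h : {nnsfun T >-> R} | forall x, (h x)%:E <= b x]])%E.
  move=> ab b0; apply: ge_ereal_sup => _ [h ha <-].
  apply: le_ereal_sup_tmp; exists (sintegral mu (proj_nnsfun h mNC)).
    exists (proj_nnsfun h mNC) => //= x; rewrite mindicE.
    have [xN|xN] := boolP (x \in ~` N).
      by rewrite mulr1 -ab//; rewrite inE in xN.
    by rewrite mulr0.
  rewrite -!integralT_nnsfun.
  rewrite (@ge0_ae_eq_integral _ _ _ mu setT (EFin \o h)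
     (EFin \o proj_nnsfun h mNC))//; try exact/measurable_EFinP.
  - by move=> x _; rewrite lee_fin.
  - by move=> x _; rewrite lee_fin.
  - exists N; split=> // x /= /not_implyP[_ hx]; apply: contrapT => Nx.
    by apply: hx; rewrite mindicE mem_set// mulr1.
have eq_nn (a b : T -> \bar R) : (forall w, ~ N w -> a w = b w) ->
    (forall w, 0 <= a w)%E -> (forall w, 0 <= b w)%E ->
    (\int[mu]_w a w = \int[mu]_w b w)%E.
  move=> ab a0 b0; rewrite !ge0_integralTE//; apply/eqP; rewrite eq_le.
  by rewrite !le_sup// => w /ab.
rewrite integralE [RHS]integralE.
congr (_ - _)%E; apply: eq_nn => // w /fg.
  by rewrite !funeposE => ->.
by rewrite !funenegE => ->.
Qed.

End integral_off_null_set.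

(** * Measures given by a density *)

Section density_measure.
Context d (T : measurableType d) (R : realType).
Variables (mu : {measure set T -> \bar R}) (f : T -> R).
Hypotheses (mf : measurable_fun setT f) (f0 : forall x, 0 <= f x).

(** The two proofs are arguments so that the measure instance can be inferred. *)
Definition density_measure of measurable_fun setT f & (forall x, 0 <= f x) :=
  fun A : set T => (\int[mu]_(x in A) (f x)%:E)%E.

Local Notation nu := (density_measure mf f0).

Let nu0 : nu set0 = 0%E. Proof. exact: integral_set0. Qed.

Let nu_ge0 A : (0 <= nu A)%E.
Proof. by apply: integral_ge0 => x _; rewrite lee_fin. Qed.

Let nu_sigma_additive : semi_sigma_additive nu.
Proof.
move=> F mF tF mUF; rewrite /density_measure ge0_integral_bigcup//; last 2 first.
- exact/measurable_EFinP/measurable_funTS.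
- by move=> x _; rewrite lee_fin.
by apply: is_cvg_ereal_nneg_natsum_cond => n _ _; exact: nu_ge0.
Qed.

HB.instance Definition _ := isMeasure.Build _ _ _ nu nu0 nu_ge0 nu_sigma_additive.

Import HBNNSimple.

Let integral_density_nnsfun (h : {nnsfun T >-> R}) :
  (\int[nu]_x (h x)%:E = \int[mu]_x ((h x)%:E * (f x)%:E))%E.
Proof.
rewrite integralT_nnsfun sintegralE.
transitivity (\int[mu]_x (\sum_(y \in range h) (y * \1_(h @^-1` [set y]) x)%:E * (f x)%:E))%E; last first.
  apply: eq_integral => x _.
  rewrite -ge0_mule_fsuml => [|y]; last exact: nnfun_muleindic_ge0.
  by rewrite fsumEFin // -(fimfunE _ x).
have mfE : measurable_fun setT (EFin \o f) by exact/measurable_EFinP.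
rewrite ge0_integral_fsum//; last 2 first.
  - move=> y; apply: emeasurable_funM => //.
    by apply/measurable_EFinP; exact: measurable_funM.
  - by move=> y x _; apply: mule_ge0; [exact: nnfun_muleindic_ge0|rewrite lee_fin].
apply: eq_fsbigr => r /[!inE] -[t _ <-].
under [RHS]eq_integral do rewrite EFinM -muleA.
rewrite ge0_integralZl ?lee_fin//.
- congr (_ * _)%E; transitivity (nu (h @^-1` [set h t])) => //.
  rewrite /density_measure integral_mkcond; apply: eq_integral => x _; rewrite /patch indicE.
  by case: ifP => _; rewrite ?mul1e ?mul0e.
- by apply: emeasurable_funM => //; exact/measurable_EFinP.
- by move=> x _; rewrite mule_ge0 ?lee_fin.
Qed.

Lemma ge0_integral_density (g : T -> \bar R) : measurable_fun setT g ->
  (forall x, 0 <= g x)%E ->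
  (\int[nu]_x g x = \int[mu]_x (g x * (f x)%:E))%E.
Proof.
move=> mg g0; pose h := nnsfun_approx measurableT mg.
have hg x : EFin \o h ^~ x @ \oo --> g x by exact: cvg_nnsfun_approx.
have nd x : {homo (fun n => (h n x)%:E) : m n / (m <= n)%N >-> (m <= n)%E}.
  by move=> m n mn; rewrite lee_fin; exact/lefP/nd_nnsfun_approx.
have mfE : measurable_fun setT (EFin \o f) by exact/measurable_EFinP.
have mh n : measurable_fun setT (fun x => (h n x)%:E).
  exact/measurable_EFinP.
have cvg_nu : (\int[nu]_x (h n x)%:E @[n --> \oo] --> \int[nu]_x g x)%E.
  under eq_integral => x _ do rewrite -(cvg_lim _ (hg x))//.
  apply: cvg_monotone_convergence => //.
  - by move=> n x _; rewrite lee_fin.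
apply: (cvg_unique (@ereal_hausdorff R) cvg_nu).
rewrite (_ : (fun n => \int[nu]_x (h n x)%:E)%E =
  (fun n => \int[mu]_x ((h n x)%:E * (f x)%:E))%E); last first.
  by apply/funext => n; exact: integral_density_nnsfun.
have gE x : (g x * (f x)%:E = limn (fun n => (h n x)%:E * (f x)%:E))%E.
  by apply/esym/cvg_lim => //; apply: cvgeZr => //; exact: hg.
rewrite (_ : (\int[mu]_x (g x * (f x)%:E))%E =
  (\int[mu]_x (limn (fun n => (h n x)%:E * (f x)%:E)))%E); last first.
  by apply: eq_integral => x _.
apply: cvg_monotone_convergence => //.
- by move=> n; exact: emeasurable_funM.
- by move=> n x _; rewrite mule_ge0 ?lee_fin.
- by move=> x _ m n mn; rewrite lee_wpmul2r ?lee_fin// -lee_fin nd.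
Qed.

End density_measure.

(** * Comparing measures on a half-line *)

Section measure_comparison.
Context {R : realType} (r0 : R).
Implicit Types m : {measure set (measurableTypeR R) -> \bar R}.

Let D : set (measurableTypeR R) := `]r0, +oo[%classic.

Let mD : measurable D. Proof. exact: measurable_itv. Qed.

Let G m r : R := fine (m `]r0, r]%classic).

Let G_increment m : (forall r, (m `]r0, r]%classic < +oo)%E) ->
  forall a b, a <= b -> m (`]a, b]%classic `&` D) = (G m b - G m a)%:E.
Proof.
move=> mfin a b ab.
have finm r : m `]r0, r]%classic \is a fin_num by rewrite ge0_fin_numE.
have mab : measurable (`]a, b]%classic `&` D : set (measurableTypeR R)).
  by apply: measurableI => //; exact: measurable_itv.
have ma : measurable (`]r0, a]%classic : set (measurableTypeR R)) by exact: measurable_itv.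
have e : (`]r0, b]%classic : set (measurableTypeR R)) =
    `]r0, a]%classic `|` (`]a, b]%classic `&` D).
  apply/seteqP; split => x; rewrite /D/= !in_itv/=.
    move=> /andP[rx xb]; rewrite rx xb/=.
    by case: (leP x a) => xa; [left|right].
  by move=> [/andP[-> xa]|[/andP[ax ->] /andP[-> _]]]//=; exact: le_trans ab.
have finab : m (`]a, b]%classic `&` D) \is a fin_num.
  rewrite ge0_fin_numE//; apply: le_lt_trans (mfin b).
  by apply: le_measure; rewrite ?inE// e => x; right.
rewrite /G e measureU//; last first.
  apply/seteqP; split => x //; rewrite /D/= !in_itv/=.
  by move=> [/andP[_ xa] [/andP[ax _] _]]; move: (le_lt_trans xa ax); rewrite ltxx.
rewrite (fineD (finm a) finab).
by rewrite -{1}(fineK finab); congr EFin; lra.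
Qed.

Let G_right_continuous m : (forall r, (m `]r0, r]%classic < +oo)%E) ->
  right_continuous (G m).
Proof.
move=> mfin a; apply/cvgrPdist_le => e e0.
pose F n : set (measurableTypeR R) := `]a, a + n.+1%:R^-1]%classic `&` D.
have mF n : measurable (F n) by apply: measurableI => //; exact: measurable_itv.
have aN n : a <= a + n.+1%:R^-1 by rewrite lerDl invr_ge0.
have F0 : \bigcap_n F n = set0.
  apply/seteqP; split => // x Fx.
  have := Fx 0%N I; rewrite /F /D/= !in_itv/= => -[/andP[ax _] _].
  have xa0 : 0 < (x - a) by rewrite subr_gt0.
  have [n _ hn] := (@cvgr_dist_lt _ _ _ _ _ (@harmonic R) 0 (@cvg_harmonic R)) _ xa0.
  have := Fx n I; rewrite /F /D/= !in_itv/= => -[/andP[_ xn] _].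
  move: (hn n (leqnn n)); rewrite /harmonic/= sub0r normrN ger0_norm ?invr_ge0//.
  by rewrite ltrBrDl ltNge xn.
have cF : m (F n) @[n --> \oo] --> 0%E.
  rewrite -(measure0 m) -F0; apply: nonincreasing_cvg_mu => //.
  - by rewrite (G_increment mfin)// ltry.
  - by rewrite F0; exact: measurable0.
  - move=> p q pq; apply/subsetPset; apply: setSI; apply: subset_itvl.
    by rewrite bnd_simp lerD2l lef_pV2 ?posrE// ler_nat.
have /fine_cvg/cvgrPdist_le/(_ _ e0)[n _ /(_ n (leqnn n))] := cF.
rewrite /= (G_increment mfin)//= sub0r normrN => hn.
have G_nd p q : p <= q -> G m p <= G m q.
  by move=> pq; rewrite -subr_ge0 -lee_fin -(G_increment mfin).
near=> x.
have ax : a <= x by near: x; exact: nbhs_right_ge.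
have xn : x <= a + n.+1%:R^-1.
  by near: x; apply: nbhs_right_le; rewrite ltrDl invr_gt0.
rewrite distrC ger0_norm ?subr_ge0 ?G_nd//; apply: le_trans hn.
by rewrite ger0_norm ?subr_ge0 ?G_nd// lerD2r G_nd.
Unshelve. all: by end_near. Qed.

(** The difference of the distribution functions is nondecreasing, and adding its
    Stieltjes measure to [m1] gives [m2] on half-open intervals. *)
Lemma le_measure_half_line (m1 m2 : {measure set (measurableTypeR R) -> \bar R}) :
  (forall r, (m2 `]r0, r]%classic < +oo)%E) ->
  (forall a b, r0 <= a -> a <= b -> (m1 `]a, b]%classic <= m2 `]a, b]%classic)%E) ->
  forall B : set (measurableTypeR R), measurable B -> B `<=` D -> (m1 B <= m2 B)%E.
Proof.
move=> fin2 le12.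
have fin1 r : (m1 `]r0, r]%classic < +oo)%E.
  have [r0r|rr0] := leP r0 r; first exact: le_lt_trans (le12 _ _ (lexx _) r0r) (fin2 r).
  by rewrite set_itv_ge ?measure0 ?ltry// bnd_simp -leNgt ltW.
pose f r : R := G m2 r - G m1 r.
have f_nd : {homo f : x y / x <= y}.
  move=> a b ab; suff : G m1 b - G m1 a <= G m2 b - G m2 a by rewrite /f; lra.
  rewrite -lee_fin -!G_increment//.
  have -> : `]a, b]%classic `&` D = `]Num.max r0 a, b]%classic.
    apply/seteqP; split => x; rewrite /D/= !in_itv/= gt_max.
      by move=> [/andP[-> ->] /andP[-> _]].
    by move=> /andP[/andP[-> ->] ->].
  have [rb|br] := leP (Num.max r0 a) b.
    by apply: le12 => //; rewrite le_max lexx.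
  by rewrite set_itv_ge ?measure0// bnd_simp -leNgt ltW.
have f_rc : right_continuous f.
  by move=> x; apply: cvgB; exact: G_right_continuous.
pose fcum : cumulative R R :=
  HB.pack f (isCumulative.Build R _ R f f_nd f_rc).
(* [f] vanishes on []-oo, r0]], so its Stieltjes measure puts no mass there, in accordance with the
   restrictions to [D]. *)
pose m1r := mrestr m1 mD.
pose m2r := mrestr m2 mD.
pose mf := lebesgue_stieltjes_measure fcum.
pose m12 := measure_add mf m1r.
have m12E A : m12 A = (mf A + m1 (A `&` D))%E by exact: measure_addE.
have eq_itv a b : a <= b -> m12 `]a, b]%classic = m2r `]a, b]%classic.
  move=> ab; rewrite m12E [RHS]/mrestr.
  rewrite [X in (X + _)%E](_ : _ = (fcum b - fcum a)%:E).
    by rewrite !G_increment// -EFinD; congr EFin; rewrite /= /f; lra.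
  rewrite /mf /lebesgue_stieltjes_measure /measure_extension measurable_mu_extE/=.
    by rewrite wlength_itv_bnd.
  exact: is_ocitv.
have eqm : forall A, measurable A -> m12 A = m2r A.
  apply: (@measure_unique _ R (measurableTypeR R) (@ocitv R)
    (fun n => `](- n%:R), n%:R]%classic) _ _ _ _ m12 m2r).
  - by [].
  - exact: ocitvI.
  - by move=> n; exact: is_ocitv.
  - apply/seteqP; split => // x _; exists (Num.bound `|x|) => //=.
    have := archi_boundP (normr_ge0 x); rewrite in_itv/= ltr_norml => /andP[-> xb].
    exact: ltW.
  - by move=> A /ocitvP[->|[[a b]/= /ltW ab ->]]; [rewrite !measure0|exact: eq_itv].
  - move=> n; have nn : - n%:R <= n%:R :> R by rewrite (@le_trans _ _ 0)// oppr_le0.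
    suff : (m2r `](- n%:R)%R, (n%:R)%R]%classic < +oo)%E by rewrite -(eq_itv _ _ nn).
    rewrite /m2r /mrestr; apply: le_lt_trans (fin2 n%:R).
    apply: le_measure; rewrite ?inE//.
      by apply: measurableI => //; exact: measurable_itv.
    by move=> x [/=]; rewrite /D/= !in_itv/= => /andP[_ ->] /andP[->].
move=> B mB BD; have := eqm B mB.
rewrite m12E /m2r /mrestr setIidl// => <-.
by rewrite leeDr.
Qed.

End measure_comparison.

(** * The process *)

Section laplace.
Context {R : realType} {d : measure_display} {Omega : measurableType d}.
Context (X : R -> Omega -> R) (P : R -> probability Omega R).
Context (alpha : R) (Lam Phi : R -> R) (v : R -> R -> R).
Hypothesis PhiS : slope_bounds alpha Lam Phi.
Hypothesis XP : markov_process X P.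
Hypothesis v_sol : forall l, 0 <= l -> cumulant_solution Phi l (v ^~ l).
Hypothesis v_laplace : forall x t l : R, 0 <= x -> 0 <= t -> 0 <= l ->
  ('E_(P x) [fun w => expR (- l * X t w)] = (expR (- x * v t l))%:E)%E.

Let mX (t : R) : 0 <= t -> measurable_fun setT (X t).
Proof. exact: (markov_measurable XP). Qed.

Let X0 (t : R) w : 0 <= t -> 0 <= X t w.
Proof. exact: (markov_ge0 XP). Qed.

Lemma measurable_expR_laplace (c t : R) : 0 <= t ->
  measurable_fun setT (fun w => expR (c * X t w)).
Proof.
move=> t0; apply: measurableT_comp; first exact: measurable_expR.
by apply: measurable_funM => //; exact: mX.
Qed.

Lemma integrable_bounded (Q : probability Omega R) (f : Omega -> R) M :
  measurable_fun setT f -> (forall w, `|f w| <= M) -> Q.-integrable setT (EFin \o f).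
Proof.
move=> mf fM; apply: measurable_bounded_integrable => //.
  by rewrite /= probability_setT ltry.
by exists M; split; [exact: num_real|move=> y My w _; exact: le_trans (fM w) (ltW My)].
Qed.

Lemma integrable_expR_laplace (Q : probability Omega R) l t : 0 <= l -> 0 <= t ->
  Q.-integrable setT (fun w => (expR (- l * X t w))%:E).
Proof.
move=> l0 t0; apply: (@integrable_bounded _ _ 1); first exact: measurable_expR_laplace.
by move=> w; rewrite ger0_norm ?expR_ge0// expR_le1 mulNr oppr_le0 mulr_ge0// X0.
Qed.

Lemma integrable_one_sub_expR (Q : probability Omega R) (l t : R) :
  0 <= l -> 0 <= t -> Q.-integrable setT (fun w => (1 - expR (- l * X t w))%:E).
Proof.
move=> l0 t0; apply: (@integrable_bounded _ _ 1).
  by apply: measurable_funB => //; exact: measurable_expR_laplace.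
move=> w; rewrite ger0_norm ?lerBlDr ?lerDl ?expR_ge0// subr_ge0 expR_le1.
by rewrite mulNr oppr_le0 mulr_ge0// X0.
Qed.

Lemma laplace (x t l : R) : 0 <= x -> 0 <= t -> 0 <= l ->
  (\int[P x]_w (expR (- l * X t w))%:E = (expR (- x * v t l))%:E)%E.
Proof. by move=> x0 t0 l0; rewrite -(v_laplace x0 t0 l0) unlock. Qed.

(** Read off the Laplace transform at [x = 1], which is nonincreasing in [l] because [X] is
    nonnegative. *)
Lemma cumulant_homo (t p q : R) : 0 <= t -> 0 <= q -> q <= p -> v t q <= v t p.
Proof.
move=> t0 q0 qp; have p0 := le_trans q0 qp.
suff : expR (- 1 * v t p) <= expR (- 1 * v t q) by rewrite ler_expR; lra.
rewrite -lee_fin -(laplace ler01 t0 p0) -(laplace ler01 t0 q0); apply: le_integral => //; try exact: integrable_expR_laplace.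
by move=> w _; rewrite lee_fin ler_expR !mulNr lerN2 ler_wpM2r// X0.
Qed.

Lemma integral_one_sub_expR (x t l : R) : 0 <= x -> 0 <= t -> 0 <= l ->
  (\int[P x]_w (1 - expR (- l * X t w))%:E = (1 - expR (- x * v t l))%:E)%E.
Proof.
move=> x0 t0 l0; under eq_integral do rewrite EFinB.
rewrite integralB//=; last 2 first.
  exact: finite_measure_integrable_cst.
  exact: integrable_expR_laplace.
by rewrite (laplace x0 t0 l0) integral_cst//= mul1e probability_setT -EFinB.
Qed.

(** Markov's inequality for [1 - expR (- X s w)], whose mean is at most [y] because [v s 1 <= 1].
    The absorption argument exploits that the bound is uniform in [s]. *)
Lemma prob_gt_le (y s delta : R) : 0 <= y -> 0 <= s -> 0 < delta ->
  (P y (X s @^-1` `]delta, +oo[) <= (y / (1 - expR (- delta)))%:E)%E.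
Proof.
move=> y0 s0 delta0; set A := X s @^-1` _.
have mA : measurable A by rewrite -[A]setTI; exact: mX.
have c0 : 0 < 1 - expR (- delta) by rewrite subr_gt0 expR_lt1 oppr_lt0.
have intA : (P y).-integrable setT (EFin \o \1_A) by exact: integrable_indic.
have h : ((1 - expR (- delta))%:E * P y A <= (1 - expR (- y * v s 1))%:E)%E.
  rewrite -(integral_one_sub_expR y0 s0 ler01).
  rewrite -[X in P y X]setIT -integral_indic// -integralZl//.
  apply: le_integral => //.
  - exact: integrableZl.
  - exact: integrable_one_sub_expR.
  - move=> w _ /=; rewrite -EFinM lee_fin indicE.
    have [|wA] := boolP (w \in A).
      rewrite inE /A/= in_itv/= andbT mulr1 => dX.
      by rewrite lerD2l lerN2 ler_expR mulN1r lerN2 ltW.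
    by rewrite mulr0 subr_ge0 expR_le1 mulN1r oppr_le0 X0.
have v1 : v s 1 <= 1 := cumulant_le PhiS (v_sol ler01) s0.
have h2 : 1 - expR (- y * v s 1) <= y.
  have := expR_ge1Dx (- y * v s 1); have : y * v s 1 <= y * 1 by rewrite ler_wpM2l.
  lra.
have PA : P y A \is a fin_num by exact: fin_num_measure.
rewrite -(fineK PA) lee_fin ler_pdivlMr// mulrC -lee_fin EFinM fineK//.
by apply: (le_trans h); rewrite lee_fin.
Qed.

(** [expR (- n%:R * X s w)] tends to the indicator of [X s w = 0], and the Laplace transform passes
    to the limit by dominated convergence. *)
Lemma prob_eq0 (y s rate : R) : 0 <= y -> 0 <= s ->
  v s n%:R @[n --> \oo] --> rate ->
  (P y (X s @^-1` [set 0%R]) = (expR (- y * rate))%:E)%E.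
Proof.
move=> y0 s0 vr; set A := X s @^-1` _.
have mA : measurable A by rewrite -[A]setTI; exact: mX.
have intA : (P y).-integrable setT (EFin \o \1_A) by exact: integrable_indic.
have cv : (expR (- y * v s n%:R))%:E @[n --> \oo] --> (expR (- y * rate))%:E.
  apply/cvg_EFin; first exact: nearW.
  apply: continuous_cvg; first exact: continuous_expR.
  exact: cvgMr.
have ae_cvg : {ae P y, forall w, setT w ->
    (expR (- n%:R * X s w))%:E @[n --> \oo] --> (\1_A w)%:E}.
  apply/aeW => w _; rewrite indicE.
  have [|wA] := boolP (w \in A).
    rewrite inE /A/= => ->; apply: cvg_near_cst; apply: nearW => n.
    by rewrite mulr0 expR0.
  have Xw : 0 < X s w.
    by rewrite lt_neqAle X0// andbT eq_sym; apply: contraNneq wA => e; rewrite inE.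
  apply/cvg_EFin; first exact: nearW.
  rewrite [X in X @ _ --> _](_ : _ = (fun n => expR (- X s w) ^+ n)); last first.
    by apply/funext => n; rewrite /= -expRM_natl mulrN mulNr.
  by apply: cvg_expr; rewrite ger0_norm ?expR_ge0// expR_lt1 oppr_lt0.
have ae_le : {ae P y, forall w n, setT w ->
    (`|(expR (- n%:R * X s w))%:E| <= (EFin \o cst 1%R) w)%E}.
  apply/aeW => w n _; rewrite abse_EFin lee_fin ger0_norm ?expR_ge0//.
  by rewrite expR_le1 mulNr oppr_le0 mulr_ge0// X0.
have [_ _] := dominated_convergence measurableT
  (fun n => measurable_int _ (integrable_expR_laplace (P y) (ler0n _ n) s0))
  (measurable_int _ intA) ae_cvg
  (finite_measure_integrable_cst (P y) 1 measurableT) ae_le.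
rewrite [X in X @ _ --> _](_ : _ = fun n => (expR (- y * v s n%:R))%:E); last first.
  by apply/funext => n; rewrite /= (laplace y0 s0 (ler0n _ n)).
move=> /(cvg_unique (@ereal_hausdorff R) cv) ->.
by rewrite integral_indic// setIT.
Qed.

(** [X t] is the increasing limit of [X t * expR (- l * X t)] as [l] decreases to 0. By
    [u * expR (- u) <= 1 - expR (- u)] each of these has mean at most
    [l^-1 * (1 - expR (- x * v t l))], hence at most [l^-1 * (x * v t l)], and [cumulant_le_exp]
    concludes. *)
Lemma moment_le (x t : R) : 0 <= x -> 0 <= t ->
  (\int[P x]_w (X t w)%:E <= (x * expR (- alpha * t))%:E)%E.
Proof.
move=> x0 t0.
pose g n w := X t w * expR (- n.+1%:R^-1 * X t w).
have gE w : (X t w)%:E = limn (fun n => (g n w)%:E).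
  apply/esym/cvg_lim => //; apply/cvg_EFin; first exact: nearW.
  rewrite -[X in _ --> X]mulr1 -expR0 -(mul0r (X t w)) -oppr0.
  apply: cvgMr; apply: continuous_cvg; first exact: continuous_expR.
  by apply: cvgMl; apply: cvgN; exact: cvg_harmonic.
rewrite (eq_integral (fun w => limn (fun n => (g n w)%:E))); last by move=> w _; exact: gE.
have mg n : measurable_fun setT (fun w => (g n w)%:E).
  apply/measurable_EFinP; apply: measurable_funM; first exact: mX.
  exact: measurable_expR_laplace.
have g0 n w : (0 <= (g n w)%:E)%E.
  by rewrite lee_fin mulr_ge0 ?X0// expR_ge0.
have g_nd w : {homo (fun n => (g n w)%:E) : m n / (m <= n)%N >-> (m <= n)%E}.
  move=> m n mn; rewrite lee_fin ler_wpM2l ?X0// ler_expR !mulNr lerN2.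
  by rewrite ler_wpM2r ?X0// lef_pV2 ?posrE// ler_nat.
rewrite monotone_convergence//.
apply: lime_le.
  apply: ereal_nondecreasing_is_cvgn => m n mn.
  by apply: ge0_le_integral => // w _; exact: g_nd.
apply: nearW => n; pose l : R := n.+1%:R^-1.
have l0 : 0 < l by rewrite invr_gt0.
apply: (@le_trans _ _ (\int[P x]_w (l^-1 * (1 - expR (- l * X t w)))%:E)%E).
  apply: ge0_le_integral => //.
  - apply/measurable_EFinP; apply: measurable_funM => //.
    by apply: measurable_funB => //; exact: measurable_expR_laplace.
  - move=> w _; rewrite lee_fin ler_pdivlMl// mulrA mulNr.
    have := expR_ge1Dx (l * X t w); have e0 := expR_gt0 (- (l * X t w)).
    have : expR (l * X t w) * expR (- (l * X t w)) = 1 by rewrite -expRD subrr expR0.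
    rewrite -/l; nra.
under eq_integral do rewrite EFinM.
rewrite integralZl//; last first.
  exact: integrable_one_sub_expR (ltW l0) t0.
rewrite (integral_one_sub_expR x0 t0 (ltW l0)) -EFinM lee_fin.
rewrite ler_pdivrMl//.
have hv := cumulant_le_exp PhiS v_sol t0 (ltW l0).
have := expR_ge1Dx (- x * v t l).
have : x * v t l <= x * (l * expR (- alpha * t)) by rewrite ler_wpM2l.
lra.
Qed.

End laplace.

Section filtration.
Context {R : realType} {d : measure_display} {Omega : measurableType d}.
Context (X : R -> Omega -> R).

Lemma natural_filtration_preimage (s t : R) (B : set R) : 0 <= s -> s <= t ->
  measurable B -> natural_filtration X t (X s @^-1` B).
Proof.
move=> s0 st mB; apply: sub_sigma_algebra; exists s; first by rewrite /= in_itv/= s0.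
by exists B => //; rewrite setTI.
Qed.

Lemma natural_filtration_measurable (t : R) :
  (forall s, 0 <= s -> measurable_fun setT (X s)) ->
  natural_filtration X t `<=` measurable.
Proof.
move=> mX; apply: smallest_sub; first exact: sigma_algebra_measurable.
move=> A [s /= /[!in_itv]/= /andP[s0 _] [B mB <-]].
exact: mX.
Qed.

(** Being in [E n] for the first time is still an event at time [t], so the Markov property can be
    applied at a first hit along a sequence of times. *)
Lemma natural_filtration_seqDU (t : R) (E : (set Omega)^nat) n :
  (forall i, (i <= n)%N -> natural_filtration X t (E i)) ->
  natural_filtration X t (seqDU E n).
Proof.
move=> hE.
pose T := g_sigma_algebraType
  (\bigcup_(s in `[0, t]) preimage_set_system setT (X s) measurable).
change (measurable (seqDU E n : set T)).
apply: measurableD; first exact: (hE n (leqnn n)).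
by apply: bigsetU_measurable => i _; exact: (hE i (ltnW (ltn_ord i))).
Qed.

End filtration.

(** Right limits exclude the point itself, so the grid point has to lie strictly after [s]. *)
Lemma grid_above {R : realType} (s h : R) : 0 <= s -> 0 < h ->
  exists i : nat, s < i.+1%:R * h <= s + h.
Proof.
move=> s0 h0; exists (Num.truncn (s / h)).
have /andP[h1 h2] := truncn_itv (divr_ge0 s0 (ltW h0)).
rewrite ltr_pdivrMr// in h2; rewrite ler_pdivlMr// in h1.
by rewrite h2/= -natr1 mulrDl mul1r lerD2r.
Qed.

(** * Absorption at zero *)

Section absorption.
Context {R : realType} {d : measure_display} {Omega : measurableType d}.
Context (X : R -> Omega -> R) (P : R -> probability Omega R).
Hypothesis XP : markov_process X P.
Hypothesis tail : forall y s delta : R, 0 <= y -> 0 <= s -> 0 < delta ->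
  (P y (X s @^-1` `]delta, +oo[) <= (y / (1 - expR (- delta)))%:E)%E.

Let mX (t : R) : 0 <= t -> measurable_fun setT (X t).
Proof. exact: (markov_measurable XP). Qed.

Let X0 (t : R) w : 0 <= t -> 0 <= X t w.
Proof. exact: (markov_ge0 XP). Qed.

Let mpre (t : R) B : 0 <= t -> measurable B -> measurable (X t @^-1` B).
Proof. by move=> t0 mB; rewrite -[X in measurable X]setTI; exact: mX. Qed.

(** Decomposition along the first index at which [X] falls below [eps]. *)
Lemma prob_low_then_high (x q eps delta : R) (u : nat -> R) :
  0 <= x -> 0 < eps -> 0 < delta ->
  {homo u : m n / (m <= n)%N >-> m <= n} -> (forall i, 0 <= u i <= q) ->
  (P x ((\bigcup_i X (u i) @^-1` `]-oo, eps[) `&` X q @^-1` `]delta, +oo[)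
  <= (eps / (1 - expR (- delta)))%:E)%E.
Proof.
move=> x0 eps0 delta0 u_nd uq; set C := X q @^-1` _.
pose E i := X (u i) @^-1` `]-oo, eps[.
pose S := seqDU E.
have u0 i : 0 <= u i by case/andP : (uq i).
have q0 : 0 <= q by case/andP : (uq 0%N) => /le_trans; exact.
have mC : measurable C by exact: mpre.
have FS i : natural_filtration X (u i) (S i).
  apply: natural_filtration_seqDU => j ji.
  by apply: natural_filtration_preimage; rewrite ?u_nd.
have mS i : measurable (S i) by exact: natural_filtration_measurable mX _ (FS i).
have c0 : 0 < 1 - expR (- delta) by rewrite subr_gt0 expR_lt1 oppr_lt0.
set k := eps / _.
have k0 : 0 <= k by rewrite divr_ge0 ?ltW.
have step i : (P x (S i `&` C) <= k%:E * P x (S i))%E.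
  have /andP[ui0 uiq] := uq i; have qu : 0 <= q - u i by rewrite subr_ge0.
  have := markov_property XP x0 ui0 qu (FS i) (measurable_itv `]delta, +oo[).
  rewrite subrKC => ->.
  rewrite -integral_cst//; apply: ge0_le_integral => //.
  - apply: (@measurable_comp _ _ _ _ _ _ (`[0, +oo[ : set R)
      (fun y => P y (X (q - u i) @^-1` `]delta, +oo[)) (S i) (X (u i))) => //.
    + by move=> _ [w _ <-] /=; rewrite in_itv/= X0.
    + exact: (markov_transition_measurable XP qu).
    + exact: measurable_funTS (mX ui0).
  - move=> w [+ _]; rewrite /E/= in_itv/= => wE.
    apply: (le_trans (tail _ qu delta0)); first exact: X0.
    by rewrite lee_fin ler_pM2r ?invr_gt0// ltW.
rewrite (seqDU_bigcup_eq E) -/S setI_bigcupl.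
rewrite measure_semi_bigcup//; last 3 first.
- by move=> i; exact: measurableI.
- by apply: trivIset_setIr; exact: trivIset_seqDU.
- by apply: bigcupT_measurable => i; exact: measurableI.
apply: (@le_trans _ _ (\sum_(i <oo) k%:E * P x (S i))%E).
  by apply: lee_nneseries => // i _; exact: step.
rewrite nneseriesZl// -measure_semi_bigcup//; last 2 first.
- exact: trivIset_seqDU.
- exact: bigcupT_measurable.
rewrite -[leRHS]mule1 lee_wpmul2l ?lee_fin// probability_le1//.
exact: bigcupT_measurable.
Qed.

(** The positive multiples of [q / 2 ^+ n], cut off at [q] so that all times stay in [[0, q]].
    Halving the mesh refines the grid, which makes [low] increase in [n]. *)
Let grid (q : R) n i : R := Num.min (i.+1%:R * (q / 2 ^+ n)) q.

Let low q eps n : set Omega := \bigcup_i X (grid q n i) @^-1` `]-oo, eps[.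

Let grid_itv q n i : 0 < q -> 0 <= grid q n i <= q.
Proof.
move=> q0; rewrite /grid ge_min lexx orbT andbT le_min (ltW q0) andbT.
by rewrite mulr_ge0// divr_ge0 ?exprn_ge0// ltW.
Qed.

Let measurable_low q eps n : 0 < q -> measurable (low q eps n).
Proof.
move=> q0; apply: bigcupT_measurable => i; apply: mpre => //.
by case/andP : (grid_itv n i q0).
Qed.

Let low_high q delta : set Omega :=
  \bigcap_m ((\bigcup_n low q m.+1%:R^-1 n) `&` X q @^-1` `]delta, +oo[).

(** For each [m] the probability is at most a constant times [m.+1%:R^-1]: by [prob_low_then_high]
    on each grid, and by continuity from below as the mesh shrinks. *)
Let prob_low_high (x q delta : R) : 0 <= x -> 0 < q -> 0 < delta ->
  P x (low_high q delta) = 0%E.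
Proof.
move=> x0 q0 delta0.
have c0 : 0 < 1 - expR (- delta) by rewrite subr_gt0 expR_lt1 oppr_lt0.
have mC : measurable (X q @^-1` `]delta, +oo[) by apply: mpre => //; exact: ltW.
have mlow m : measurable (\bigcup_n low q m.+1%:R^-1 n).
  by apply: bigcupT_measurable => n; exact: measurable_low.
have bound m : (P x (low_high q delta)
    <= (m.+1%:R^-1 / (1 - expR (- delta)))%:E)%E.
  apply: (@le_trans _ _
      (P x ((\bigcup_n low q m.+1%:R^-1 n) `&` X q @^-1` `]delta, +oo[))).
    apply: le_measure; rewrite ?inE//.
    - by apply: bigcapT_measurable => p; exact: measurableI.
    - exact: measurableI.
    - by move=> w; apply.
  rewrite setI_bigcupl.
  pose G n := low q m.+1%:R^-1 n `&` X q @^-1` `]delta, +oo[.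
  have mG n : measurable (G n) by apply: measurableI => //; exact: measurable_low.
  have cG : P x (G n) @[n --> \oo] --> P x (\bigcup_n G n).
    apply: nondecreasing_cvg_mu => //; first exact: bigcupT_measurable.
    apply/nondecreasing_seqP => n; apply/subsetPset; apply: setSI => w [i _ wi].
    (* Index [i] stands for the multiple [i.+1] of the mesh, which is the multiple [i.*2.+2] of half
       the mesh. *)
    exists i.*2.+1 => //; rewrite /grid (_ : i.*2.+2%:R * (q / 2 ^+ n.+1) =
      i.+1%:R * (q / 2 ^+ n))//.
    have -> : i.*2.+2 = (2 * i.+1)%N by rewrite mulnS mul2n.
    by rewrite natrM exprS invfM (mulrCA q) mulrACA divff ?mul1r.
  rewrite -(cvg_lim _ cG)//; apply: lime_le; first by apply/cvg_ex; eexists; exact: cG.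
  apply: nearW => n; apply: prob_low_then_high => //.
  - move=> i j ij; rewrite /grid le_min !ge_min lexx orbT andbT.
    by rewrite ler_wpM2r ?ler_nat// divr_ge0 ?exprn_ge0// ltW.
  - by move=> i; exact: grid_itv.
apply/eqP; rewrite eq_le measure_ge0 andbT.
have c : (m.+1%:R^-1 / (1 - expR (- delta)))%:E @[m --> \oo] --> 0%E.
  apply/cvg_EFin; first exact: nearW.
  rewrite -[X in _ --> X](mul0r (1 - expR (- delta))^-1).
  by apply: cvgMl; exact: cvg_harmonic.
rewrite -(cvg_lim _ c)//; apply: lime_ge; first by apply/cvg_ex; eexists; exact: c.
by apply: nearW => m; exact: bound.
Qed.

(** Right continuity reduces the uncountably many pairs [(s, t)] to countably many events: some
    [q = j.+1%:R * k.+1%:R^-1] just after [t] still has [X q w > X t w / 2], and grid points just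
    after [s] bring [X] below every [m.+1%:R^-1]. *)
Lemma absorption_negligible (x : R) : 0 <= x ->
  (P x).-negligible
    [set w | exists s t, [/\ 0 <= s, s <= t, X s w = 0 & X t w != 0]].
Proof.
move=> x0.
apply: (@negligibleS _ _ _ _ (\bigcup_j \bigcup_k \bigcup_p
  low_high (j.+1%:R * k.+1%:R^-1) p.+1%:R^-1)); last first.
  apply: negligible_bigcup => j; apply: negligible_bigcup => k.
  apply: negligible_bigcup => p.
  have q0 : 0 < j.+1%:R * k.+1%:R^-1 :> R by rewrite mulr_gt0// invr_gt0.
  apply/negligibleP; last by apply: prob_low_high; rewrite ?invr_gt0.
  apply: bigcapT_measurable => m; apply: measurableI.
    by apply: bigcupT_measurable => n; exact: measurable_low.
  by apply: mpre => //; exact: ltW.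
move=> w [s [t [s0 st Xs Xt]]].
have t0 := le_trans s0 st.
have {Xt}Xt : 0 < X t w by rewrite lt_neqAle eq_sym Xt X0.
have {st}st : s < t.
  by rewrite lt_neqAle st andbT; apply: contraTneq Xt => <-; rewrite Xs ltxx.
have [rc _] := markov_rcll XP w.
have e2 : 0 < X t w / 2 by rewrite divr_gt0.
have /cvgrPdist_lt/(_ _ e2) [a /= a0 ha] := rc _ t0.
have [k _ hk] := (@cvgr_dist_lt _ _ _ _ _ (@harmonic R) 0 (@cvg_harmonic R)) _ a0.
have {}hk : k.+1%:R^-1 < a.
  by move: (hk k (leqnn k)); rewrite /harmonic/= sub0r normrN ger0_norm ?invr_ge0.
have k0 : 0 < k.+1%:R^-1 :> R by rewrite invr_gt0.
have [j /andP[tj jt]] := grid_above t0 k0.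
set q : R := _ * _ in tj jt.
have Xq : X t w / 2 < X q w.
  have : `|X t w - X q w| < X t w / 2.
    apply: ha => //=; rewrite distrC ger0_norm ?subr_ge0 ?ltW//.
    by rewrite ltrBlDl (le_lt_trans jt)// ltrD2l.
  by rewrite ltr_norml => /andP[_]; lra.
have [p _ hp] := (@cvgr_dist_lt _ _ _ _ _ (@harmonic R) 0 (@cvg_harmonic R)) _ e2.
have {}hp : p.+1%:R^-1 < X t w / 2.
  by move: (hp p (leqnn p)); rewrite /harmonic/= sub0r normrN ger0_norm ?invr_ge0.
exists j => //; exists k => //; exists p => // m _; split; last first.
  by rewrite /= in_itv/= andbT -/q (lt_trans hp).
rewrite -/q.
have m0 : 0 < m.+1%:R^-1 :> R by rewrite invr_gt0.
have /cvgrPdist_lt/(_ _ m0) [b /= b0 hb] := rc _ s0.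
have q0 : 0 < q by rewrite (le_lt_trans t0).
(* A mesh below [b] puts the next grid point after [s] where [X] is small; a mesh below [q - s]
   keeps that point below [q], where the cutoff has no effect. *)
have [n hn] : exists n : nat, q / 2 ^+ n < Num.min b (q - s).
  have bq : 0 < Num.min b (q - s) by rewrite lt_min b0 subr_gt0 (lt_trans st).
  exists (Num.bound (q / Num.min b (q - s))).
  rewrite ltr_pdivrMr ?exprn_gt0// mulrC -ltr_pdivrMr//.
  apply: (lt_trans (archi_boundP _)); first by rewrite divr_ge0// ltW.
  by rewrite -natrX ltr_nat ltn_expl.
move: hn; rewrite lt_min => /andP[nb nq].
have h0 : 0 < q / 2 ^+ n by rewrite divr_gt0// exprn_gt0.
have [i /andP[si is_]] := grid_above s0 h0.
exists n => //; exists i => //=; rewrite in_itv/=.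
have -> : grid q n i = i.+1%:R * (q / 2 ^+ n) by rewrite /grid min_l//; lra.
set g := _ * _ in si is_ *.
have := hb g; rewrite /= Xs sub0r normrN => h.
have : `|X g w| < m.+1%:R^-1.
  apply: h => //; rewrite distrC ger0_norm ?subr_ge0 ?ltW//.
  by rewrite ltrBlDl (le_lt_trans is_)// ltrD2l.
by rewrite ltr_norml => /andP[].
Qed.

End absorption.

(** * A measurable version of the extinction time *)

Lemma measurable_fun_ray {d : measure_display} {T : measurableType d} {R : realType}
    (f : T -> R) :
  (forall r, measurable (f @^-1` `]r, +oo[)) -> measurable_fun setT f.
Proof.
move=> mf; apply: (measurability (@RGenOInfty.G R)).
  exact: RGenOInfty.measurableE.
by move=> _ [_ [r ->] <-]; rewrite setTI; exact: mf.
Qed.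

Section extinction_clock.
Context {R : realType} {d : measure_display} {Omega : measurableType d}.
Context (X : R -> Omega -> R) (P : R -> probability Omega R) (x : R) (rate : R -> R).
Hypothesis XP : markov_process X P.
Hypothesis x0 : 0 < x.
Hypothesis absorb : (P x).-negligible
  [set w | exists s t, [/\ 0 <= s, s <= t, X s w = 0 & X t w != 0]].
Hypothesis prob0 : forall s : R, 0 < s ->
  P x (X s @^-1` [set 0%R]) = (expR (- x * rate s))%:E.
Hypothesis rate_cvg0 : forall e, 0 < e -> exists2 r0, 0 < r0 &
  forall r, r0 <= r -> rate r <= e.

Let mX (t : R) : 0 <= t -> measurable_fun setT (X t).
Proof. exact: (markov_measurable XP). Qed.

Let X0 (t : R) w : 0 <= t -> 0 <= X t w.
Proof. exact: (markov_ge0 XP). Qed.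

Let mX0 (t : R) : 0 <= t -> measurable (X t @^-1` [set 0]).
Proof. by move=> t0; rewrite -[X in measurable X]setTI; exact: mX. Qed.

(** Being nonzero at time [n.+1%:R] has probability at most [x * rate n.+1%:R], which tends to 0. *)
Let never_zero_negligible :
  (P x).-negligible (\bigcap_n ~` (X n.+1%:R @^-1` [set 0])).
Proof.
have mN : measurable (\bigcap_n ~` (X n.+1%:R @^-1` [set 0])).
  by apply: bigcapT_measurable => n; apply: measurableC; exact: mX0.
apply/negligibleP => //; apply/eqP; rewrite eq_le measure_ge0 andbT.
apply/lee_addgt0Pr => e e0; rewrite add0e.
have [r0 r00 hr0] := rate_cvg0 (divr_gt0 e0 x0).
pose n := Num.bound r0.
have rn : r0 <= n.+1%:R.
  by apply: (le_trans (ltW (archi_boundP (ltW r00)))); rewrite ler_nat.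
apply: (@le_trans _ _ (P x (~` (X n.+1%:R @^-1` [set 0])))).
  apply: le_measure; rewrite ?inE//; first by apply: measurableC; exact: mX0.
  by move=> w /(_ n I).
rewrite probability_setC; last exact: mX0.
rewrite prob0// -EFinB lee_fin.
have := expR_ge1Dx (- x * rate n.+1%:R); have := hr0 _ rn.
rewrite ler_pdivlMr//; lra.
Qed.

Let start_negligible : (P x).-negligible (~` [set w | X 0 w = x]).
Proof.
have m0 : measurable [set w | X 0 w = x].
  by rewrite -[X in measurable X]setTI; exact: (mX (lexx 0)) (measurable_set1 x).
apply/negligibleP; first exact: measurableC.
suff : P x (~` [set w | X 0 w = x]) = 0%E by [].
by rewrite probability_setC// (markov_start XP (ltW x0)) subee.
Qed.

(** Right continuity prolongs positivity, absorption propagates zeros. *)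
Let extinction_time_gt w (r : R) : 0 <= r ->
  (forall s t, 0 <= s -> s <= t -> X s w = 0 -> X t w = 0) ->
  0 < X r w -> (r%:E < extinction_time X w)%E.
Proof.
move=> r0 abs Xr.
have [rc _] := markov_rcll XP w.
have /cvgrPdist_lt/(_ _ Xr) [a /= a0 ha] := rc _ r0.
apply: (@lt_le_trans _ _ (r + a)%:E); first by rewrite lte_fin ltrDl.
apply: le_ereal_inf_tmp => _ [s [s0 Xs] <-]; rewrite lee_fin leNgt.
apply/negP => sra.
have [sr|rs] := leP s r.
  by move: Xr; rewrite (abs s r)// ?ltxx// ltW.
have : `|X r w - X s w| < X r w.
  by apply: ha => //=; rewrite distrC ger0_norm ?subr_ge0 ?ltW// ltrBlDl.
by rewrite Xs subr0 ger0_norm ?X0// ltxx.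
Qed.

(** Off [N], zero is absorbing, is reached, and the path starts at [x > 0]. The equivalence with
    [X r w != 0] also makes [T] measurable, since it describes a ray by the state at one fixed
    time. *)
Lemma extinction_clock : exists (T : Omega -> R) (N : set Omega),
  [/\ measurable_fun setT T, measurable N, P x N = 0%E &
   forall w, ~ N w -> [/\ extinction_time X w = (T w)%:E, 0 < T w &
      forall r, 0 < r -> (r < T w) = (X r w != 0)]].
Proof.
have [N [mN N0 subN]] : (P x).-negligible
    ([set w | exists s t, [/\ 0 <= s, s <= t, X s w = 0 & X t w != 0]] `|`
     ((\bigcap_n ~` (X n.+1%:R @^-1` [set 0])) `|` ~` [set w | X 0 w = x])).
  by apply: negligibleU => //; exact: negligibleU.
have good w : ~ N w -> [/\ forall s t, 0 <= s -> s <= t -> X s w = 0 -> X t w = 0,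
    exists n, X n.+1%:R w = 0 & X 0 w = x].
  move=> Nw; split.
  - move=> s t s0 st Xs; apply: contrapT => /eqP Xt.
    by apply: Nw; apply: subN; left; exists s, t.
  - apply: contrapT => /forallNP h; apply: Nw; apply: subN; right; left.
    by move=> n _; exact: h.
  - by apply: contrapT => h; apply: Nw; apply: subN; right; right.
(* The value 1 keeps [T] positive on [N] and makes the trace on [N] of the preimage of a ray either
   [N] or empty. *)
pose T w : R := if w \in N then 1 else fine (extinction_time X w).
have TH w : ~ N w -> [/\ extinction_time X w = (T w)%:E, 0 < T w &
      forall r, 0 < r -> (r < T w) = (X r w != 0)].
  move=> Nw; have [abs [n Xn] X0x] := good w Nw.
  have Hn : (extinction_time X w <= n.+1%:R%:E)%E.
    by apply: ereal_inf_lbound; exists n.+1%:R.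
  have H0 : (0%:E < extinction_time X w)%E.
    by apply: extinction_time_gt => //; rewrite X0x.
  have Hfin : extinction_time X w \is a fin_num.
    by rewrite ge0_fin_numE ?ltW// (le_lt_trans Hn)// ltry.
  have HT : extinction_time X w = (T w)%:E.
    by rewrite /T memNset// fineK.
  split=> //; first by rewrite -lte_fin -HT.
  move=> r r0; rewrite -lte_fin -HT; apply/idP/idP.
    move=> rH; apply: contraTneq rH => Xr; rewrite -leNgt.
    by apply: ereal_inf_lbound; exists r.
  move=> Xr; apply: extinction_time_gt => //; first exact: ltW.
  by rewrite lt_neqAle eq_sym Xr X0// ltW.
exists T, N; split => //.
apply: measurable_fun_ray => r.
have T0 w : 0 < T w.
  by have [wN|/negP wN] := boolP (w \in N); [rewrite /T wN|
     have [] := TH w (fun h => wN (mem_set h))].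
have [rle0|r0] := leP r 0.
  rewrite (_ : _ @^-1` _ = setT)//; apply/seteqP; split => // w _ /=.
  by rewrite in_itv/= andbT (le_lt_trans rle0).
rewrite (_ : _ @^-1` _ = (~` N `&` ~` (X r @^-1` [set 0])) `|`
    (if r < 1 then N else set0)).
  apply: measurableU; last by case: ifP.
  by apply: measurableI; [exact: measurableC|apply: measurableC; apply: mX0; exact: ltW].
apply/seteqP; split => w /=; rewrite in_itv/= andbT.
  have [wN|/negP wN] := boolP (w \in N).
    by rewrite /T wN => ->; right; rewrite inE in wN.
  have nw : ~ N w by move=> h; exact: wN (mem_set h).
  have [_ _ ->//] := TH w nw; move=> /eqP Xr; left; split => //.
move=> [[nw /eqP Xr]|].
  by have [_ _ ->] := TH w nw.
by case: ifP => // r1 Nw; rewrite /T mem_set.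
Qed.

End extinction_clock.

(** * Image measures and integrals over preimages *)

Section image_measures.
Context {d : measure_display} {Omega : measurableType d} {R : realType}.
Implicit Types (m : {measure set Omega -> \bar R}) (T F f : Omega -> R).

Lemma image_measure m T : measurable_fun setT T ->
  exists nu : {measure set (measurableTypeR R) -> \bar R},
    forall A, nu A = m (T @^-1` A).
Proof.
move=> mT.
by exists (@measure_function_pushforward__canonical__measure_function_Measure
  _ _ Omega (measurableTypeR R) R m T mT).
Qed.

Lemma density_exists m f : measurable_fun setT f -> (forall w, 0 <= f w) ->
  exists nu : {measure set Omega -> \bar R},
    (forall A, nu A = \int[m]_(w in A) (f w)%:E)%E /\
    (forall g : Omega -> \bar R, measurable_fun setT g -> (forall w, 0 <= g w)%E ->
      \int[nu]_w g w = \int[m]_w (g w * (f w)%:E))%E.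
Proof.
move=> mf f0; exists (density_measure m mf f0); split => // g mg g0.
exact: ge0_integral_density.
Qed.

(** The measures with densities [f1] and [f2] have the same image under [F], and the integral of [F]
    depends on this image alone. It carries the Markov property from events to nonnegative
    functions. *)
Lemma eq_integral_from_preimages m F f1 f2 :
  measurable_fun setT F -> (forall w, 0 <= F w) ->
  measurable_fun setT f1 -> (forall w, 0 <= f1 w) ->
  measurable_fun setT f2 -> (forall w, 0 <= f2 w) ->
  (forall C : set R, measurable C ->
    \int[m]_(w in F @^-1` C) (f1 w)%:E = \int[m]_(w in F @^-1` C) (f2 w)%:E)%E ->
  (\int[m]_w (F w * f1 w)%:E = \int[m]_w (F w * f2 w)%:E)%E.
Proof.
move=> mF F0 mf1 f10 mf2 f20 h.
have key f : measurable_fun setT f -> (forall w, 0 <= f w) ->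
    forall nu : {measure set Omega -> \bar R},
    (forall g : Omega -> \bar R, measurable_fun setT g -> (forall w, 0 <= g w)%E ->
      \int[nu]_w g w = \int[m]_w (g w * (f w)%:E))%E ->
    (\int[m]_w (F w * f w)%:E =
     \int[pushforward nu F]_(y in [set: measurableTypeR R]) `|y|%:E)%E.
  move=> mf f0 nu nuE.
  rewrite [RHS]ge0_integral_pushforward//=; last first.
    by apply/measurable_EFinP; apply: normr_measurable.
  rewrite preimage_setT.
  transitivity (\int[nu]_w (F w)%:E)%E.
    rewrite nuE//; first exact/measurable_EFinP.
  by apply: eq_integral => w _ /=; rewrite ger0_norm.
have [nu1 [nu1E nu1I]] := density_exists m mf1 f10.
have [nu2 [nu2E nu2I]] := density_exists m mf2 f20.
rewrite (key f1 mf1 f10 nu1 nu1I) (key f2 mf2 f20 nu2 nu2I).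
apply: eq_measure_integral => A mA _.
rewrite /pushforward; exact: (etrans (nu1E _) (etrans (h A mA) (esym (nu2E _)))).
Qed.

(** [le_measure_half_line], applied to the images under [T] of the measure with density [f] and of
    [c] times [m]. *)
Lemma le_integral_preimage_half_line m T f (c r0 : R) :
  measurable_fun setT T -> measurable_fun setT f -> (forall w, 0 <= f w) ->
  (m setT < +oo)%E -> 0 <= c ->
  (forall a b : R, r0 <= a -> a <= b ->
    (\int[m]_(w in T @^-1` `]a, b]%classic) (f w)%:E <= c%:E * m (T @^-1` `]a, b]%classic))%E) ->
  forall B : set R, measurable B -> B `<=` `]r0, +oo[ ->
  (\int[m]_(w in T @^-1` B) (f w)%:E <= c%:E * m (T @^-1` B))%E.
Proof.
move=> mT mf f0 mfin c0 h B mB BD.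
have [nu [nuE _]] := density_exists m mf f0.
have [nuT nuTE] := image_measure nu mT.
have [mm mmE] := image_measure m mT.
pose m2 := mscale (NngNum c0) mm.
have m2E A : m2 A = (c%:E * m (T @^-1` A))%E by rewrite -mmE.
have := @le_measure_half_line R r0 nuT m2; rewrite /= => le.
rewrite -nuE -nuTE -m2E; apply: le => //.
- move=> r; change (m2 `]r0, r]%classic < +oo)%E; rewrite m2E lte_mul_pinfty ?lee_fin//.
  apply: le_lt_trans mfin; apply: le_measure; rewrite ?inE//.
  by rewrite -[X in measurable X]setTI; exact: (mT measurableT _ (measurable_itv _)).
- move=> a b ra ab; change (nuT `]a, b]%classic <= m2 `]a, b]%classic)%E.
  by rewrite m2E nuTE nuE; exact: h.
Qed.

End image_measures.

(** * Conditioning on extinction at a late time *)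

Section conditioning.
Context {R : realType} {d : measure_display} {Omega : measurableType d}.
Context (X : R -> Omega -> R) (P : R -> probability Omega R) (x : R).
Context (alpha : R) (Lam Phi : R -> R) (v : R -> R -> R).
Context (T : Omega -> R) (N : set Omega).
Hypothesis PhiS : slope_bounds alpha Lam Phi.
Hypothesis Phi_gt0 : forall l, 0 < l -> 0 < Phi l.
Hypothesis Lam_near0 : forall e, 0 < e -> exists2 p, 0 < p & Lam p <= alpha + e.
Hypothesis flow_bounded : forall t, 0 < t ->
  exists M, forall u, is_flow Phi u -> u t <= M.
Hypothesis XP : markov_process X P.
Hypothesis x0 : 0 < x.
Hypothesis v_sol : forall l, 0 <= l -> cumulant_solution Phi l (v ^~ l).
Hypothesis v_homo : forall t p q, 0 <= t -> 0 <= q -> q <= p -> v t q <= v t p.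
Notation rate := (extinction_rate v).
Hypothesis prob0 : forall y s : R, 0 <= y -> 0 < s ->
  P y (X s @^-1` [set 0%R]) = (expR (- y * rate s))%:E.
Hypothesis moment : forall t : R, 0 <= t ->
  (\int[P x]_w (X t w)%:E <= (x * expR (- alpha * t))%:E)%E.
Hypothesis mT : measurable_fun setT T.
Hypothesis mN : measurable N.
Hypothesis N0 : P x N = 0%E.
Hypothesis TN : forall w, ~ N w -> forall r, 0 < r -> (r < T w) = (X r w != 0).

Let Q := P x.

Let mX (t : R) : 0 <= t -> measurable_fun setT (X t).
Proof. exact: (markov_measurable XP). Qed.

Let X0 (t : R) w : 0 <= t -> 0 <= X t w.
Proof. exact: (markov_ge0 XP). Qed.

Let mX0 (t : R) : 0 <= t -> measurable (X t @^-1` [set 0]).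
Proof. by move=> t0; rewrite -[X in measurable X]setTI; exact: mX. Qed.

Let mTB B : measurable B -> measurable (T @^-1` B).
Proof. by move=> mB; rewrite -[X in measurable X]setTI; exact: mT. Qed.

Lemma filtration_measurable_fun (t : R) F : filtration_measurable X t F ->
  measurable_fun setT F.
Proof.
move=> mF _ B mB; apply: (natural_filtration_measurable mX).
by apply: mF; exists B.
Qed.

Let rate_gt0 (r : R) : 0 < r -> 0 < rate r.
Proof. exact: (extinction_rate_gt0 PhiS flow_bounded v_sol v_homo). Qed.

(** The Markov property at time [t] for the state 0: from [X t w], being at 0 after a further
    [r - t] has probability [expR (- X t w * rate (r - t))]. *)
Lemma markov_extinct (t r : R) (F : Omega -> R) : 0 <= t -> t < r ->
  filtration_measurable X t F -> (forall w, 0 <= F w) ->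
  (\int[Q]_w (F w * \1_(X r @^-1` [set 0%R]) w)%:E =
   \int[Q]_w (F w * expR (- X t w * rate (r - t)))%:E)%E.
Proof.
move=> t0 tr mF F0; have r0 := le_trans t0 (ltW tr).
have rt0 : 0 < r - t by rewrite subr_gt0.
apply: eq_integral_from_preimages => //.
- exact: filtration_measurable_fun mF.
- exact/measurable_indicP/mX0.
- apply: measurableT_comp; first exact: measurable_expR.
  by apply: measurable_funM => //; apply: measurable_funN; exact: mX.
- move=> C mC.
  have FC : natural_filtration X t (F @^-1` C) by apply: mF; exists C => //; rewrite setTI.
  have mFC : measurable (F @^-1` C) := natural_filtration_measurable mX FC.
  rewrite integral_indic//; last exact: mX0.
  rewrite setIC.
  have := markov_property XP (ltW x0) t0 (ltW rt0) FC (measurable_set1 0).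
  rewrite subrKC => markov; apply: (etrans markov); apply: eq_integral => w _.
  by rewrite prob0// X0.
Qed.

Let integrable_bnd (f : Omega -> R) (M : R) : measurable_fun setT f ->
  (forall w, `|f w| <= M) -> Q.-integrable setT (EFin \o f).
Proof. exact: integrable_bounded. Qed.

Lemma integrable_moment (t : R) (F : Omega -> R) (M : R) : 0 <= t -> measurable_fun setT F ->
  (forall w, `|F w| <= M) -> Q.-integrable setT (EFin \o (fun w => X t w * F w)).
Proof.
move=> t0 mF FM.
have iX : Q.-integrable setT (EFin \o X t).
  apply/integrableP; split; first exact/measurable_EFinP/mX.
  rewrite (eq_integral (fun w => (X t w)%:E)); last first.
    by move=> w _ /=; rewrite ger0_norm// X0.
  by apply: le_lt_trans (moment t0) _; rewrite ltry.
have iMX := @integrableZl _ _ _ Q setT measurableT M _ iX.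
apply: (le_integrable measurableT _ _ iMX).
  by apply/measurable_EFinP; apply: measurable_funM => //; exact: mX.
move=> w _ /=; rewrite lee_fin normrM (normrM M) mulrC.
by rewrite ler_wpM2r// (le_trans (FM w))// ler_norm.
Qed.

Lemma clock_indic (a b : R) w : ~ N w -> 0 < a -> a <= b ->
  \1_(T @^-1` `]a, b]) w =
  \1_(X b @^-1` [set 0]) w - \1_(X a @^-1` [set 0]) w :> R.
Proof.
move=> Nw a0 ab; have b0 := lt_le_trans a0 ab.
have ha := TN Nw a0; have hb := TN Nw b0.
rewrite !indicE.
have -> : (w \in T @^-1` `]a, b]) = (a < T w) && ~~ (b < T w).
  by apply/idP/idP; rewrite inE/= in_itv/= -leNgt.
have -> : (w \in X b @^-1` [set 0]) = ~~ (b < T w).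
  by rewrite hb negbK; apply/idP/eqP; rewrite inE.
have -> : (w \in X a @^-1` [set 0]) = ~~ (a < T w).
  by rewrite ha negbK; apply/idP/eqP; rewrite inE.
case: (ltP b (T w)) => bT; first by rewrite (le_lt_trans ab bT)/= subrr.
by case: (ltP a (T w)) => aT /=; rewrite ?subr0 ?subrr.
Qed.

Lemma integral_clock (a b : R) (F : Omega -> R) : 0 < a -> a <= b ->
  (\int[Q]_(w in T @^-1` `]a, b]%classic) (F w)%:E =
   \int[Q]_w (F w * \1_(X b @^-1` [set 0%R]) w - F w * \1_(X a @^-1` [set 0%R]) w)%:E)%E.
Proof.
move=> a0 ab; rewrite integral_mkcond; apply: (eq_integral_off_null mN N0) => w Nw.
rewrite -mulrBr -(clock_indic Nw a0 ab) /patch indicE.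
by case: ifP => _; rewrite ?mulr1 ?mulr0.
Qed.

Lemma prob_clock (a b : R) : 0 < a -> a <= b ->
  Q (T @^-1` `]a, b]) = (expR (- x * rate b) - expR (- x * rate a))%:E.
Proof.
move=> a0 ab; have b0 := lt_le_trans a0 ab.
have ind s : 0 < s -> Q.-integrable setT (EFin \o \1_(X s @^-1` [set 0%R])).
  by move=> s0; apply: integrable_indic => //; apply: mX0; exact: ltW.
rewrite -[X in Q X]setIT -integral_indic//; last exact: mTB (measurable_itv _).
transitivity (\int[Q]_w (\1_(X b @^-1` [set 0%R]) w - \1_(X a @^-1` [set 0%R]) w)%:E)%E.
  by apply: (eq_integral_off_null mN N0) => w Nw; rewrite (clock_indic Nw a0 ab).
under eq_integral do rewrite EFinB.
rewrite integralB//; [|exact: ind|exact: ind].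
rewrite !integral_indic//; try exact: mX0 (ltW _).
by rewrite !setIT EFinB; congr (_ - _)%E; exact: (prob0 (ltW x0)).
Qed.

Lemma integral_clock_le (t a b M : R) (F : Omega -> R) : 0 <= t -> t < a -> a <= b ->
  filtration_measurable X t F -> (forall w, 0 <= F w <= M) ->
  (\int[Q]_(w in T @^-1` `]a, b]%classic) (F w)%:E <=
   (rate (a - t) - rate (b - t))%:E * \int[Q]_w (X t w * F w)%:E)%E.
Proof.
move=> t0 ta ab mF FM.
have a0 := le_lt_trans t0 ta; have b0 := lt_le_trans a0 ab; have tb := lt_le_trans ta ab.
have F0 w : 0 <= F w by case/andP : (FM w).
have FMn w : `|F w| <= M by rewrite ger0_norm//; case/andP : (FM w).
have mF' := filtration_measurable_fun mF.
have iI (s : R) : 0 < s -> Q.-integrable setT (EFin \o (fun w => F w * \1_(X s @^-1` [set 0]) w)).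
  move=> s0; apply: (@integrable_bnd _ M).
    by apply: measurable_funM => //; apply/measurable_indicP; apply: mX0; exact: ltW.
  by move=> w; rewrite normrM (le_trans _ (FMn w))// ler_piMr// ger0_norm// indicE.
have mE r : measurable_fun setT (fun w => expR (- X t w * r)).
  apply: measurableT_comp; first exact: measurable_expR.
  by apply: measurable_funM => //; apply: measurable_funN; exact: mX.
have iE r : 0 <= r -> Q.-integrable setT (EFin \o (fun w => F w * expR (- X t w * r))).
  move=> r0; apply: (@integrable_bnd _ M); first exact: measurable_funM.
  move=> w; rewrite normrM (le_trans _ (FMn w))// ler_piMr// ger0_norm ?expR_ge0//.
  by rewrite expR_le1 mulNr oppr_le0 mulr_ge0// X0.
have at0 : 0 < a - t by rewrite subr_gt0.
have bt0 : 0 < b - t by rewrite subr_gt0.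
have rab : rate (b - t) <= rate (a - t).
  apply: (extinction_rate_nonincr PhiS flow_bounded v_sol v_homo) => //.
  by rewrite lerD2r.
have ra := ltW (rate_gt0 at0); have rb := ltW (rate_gt0 bt0).
rewrite integral_clock//.
under eq_integral do rewrite EFinB.
rewrite integralB//; [|exact: iI|exact: iI].
rewrite (markov_extinct t0 tb mF F0) (markov_extinct t0 ta mF F0).
rewrite -integralB//; [|exact: iE|exact: iE].
have iXF := integrable_moment t0 mF' FMn.
rewrite -integralZl//.
apply: le_integral => //.
- by apply: integrableB => //; exact: iE.
- exact: integrableZl.
move=> w _ /=; rewrite -EFinB -EFinM lee_fin.
move: (rate (a - t)) (rate (b - t)) rab ra rb => p q qp p0 q0.
have Xt := X0 w t0; have := F0 w; move: (X t w) (F w) Xt => y f y0 f0.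
rewrite -mulrBr (_ : (p - q) * (y * f) = f * (y * (p - q))); last by ring.
rewrite ler_wpM2l//.
have := expR_ge1Dx (- y * p - - y * q).
have e : expR (- y * p) = expR (- y * q) * expR (- y * p - - y * q).
  by rewrite -expRD; congr expR; lra.
have e1 : expR (- y * q) <= 1 by rewrite expR_le1 mulNr oppr_le0 mulr_ge0.
have e0 := expR_gt0 (- y * q).
have : 0 <= y * (p - q) by rewrite mulr_ge0// subr_ge0.
rewrite e; nra.
Qed.


Let integrable_F S (F : Omega -> R) (M : R) : measurable S -> measurable_fun setT F ->
  (forall w, `|F w| <= M) -> Q.-integrable S (EFin \o F).
Proof.
by move=> mS mF FM; apply: integrableS (integrable_bnd mF FM).
Qed.

(** The limit [L] of the theorem, as a real number. *)
Definition tilted_mean (t : R) (F : Omega -> R) : R :=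
  x^-1 * (expR (alpha * t) * \int[Q]_w (X t w * F w)).

Let rate_cvg0 e : 0 < e -> exists2 r0, 0 < r0 & forall r, r0 <= r -> rate r <= e.
Proof. exact: (extinction_rate_cvg0 PhiS Phi_gt0 flow_bounded v_sol v_homo). Qed.

Let rate_nonincr (a b : R) : 0 < a -> a <= b -> rate b <= rate a.
Proof. exact: (extinction_rate_nonincr PhiS flow_bounded v_sol v_homo). Qed.

Lemma expR_increment_ge (p q : R) : 0 <= q -> q <= p ->
  x * (p - q) * expR (- x * p) <= expR (- x * q) - expR (- x * p).
Proof.
move=> q0 qp; have e0 := expR_gt0 (- x * p).
have h := expR_ge1Dx (x * (p - q)).
have : expR (- x * q) = expR (- x * p) * expR (x * (p - q)).
  by rewrite -expRD; congr expR; lra.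
nra.
Qed.

(** A bound proportional to [b - a]: it gives survival a positive probability and lets Lebesgue
    measure be compared with the law of [T]. *)
Lemma clock_lower (a b : R) : 0 < a -> a <= b ->
  x * (Phi (rate b) * (b - a)) * expR (- x * rate a) <= fine (Q (T @^-1` `]a, b])).
Proof.
move=> a0 ab; have b0 := lt_le_trans a0 ab; rewrite prob_clock//=.
apply: le_trans (expR_increment_ge (ltW (rate_gt0 b0)) (rate_nonincr a0 ab)).
rewrite ler_wpM2r ?expR_ge0// ler_wpM2l ?(ltW x0)//.
exact: (extinction_rate_decay PhiS flow_bounded v_sol v_homo).
Qed.

Lemma conditional_upper_ge0 (t M e : R) (F : Omega -> R) : 0 <= t -> 0 < e ->
  filtration_measurable X t F -> (forall w, 0 <= F w <= M) ->
  exists2 r0, 0 < r0 & forall B : set R, measurable B -> B `<=` `]r0, +oo[ ->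
    (\int[Q]_(w in T @^-1` B) (F w)%:E <=
     (tilted_mean t F + e)%:E * Q (T @^-1` B))%E.
Proof.
move=> t0 e0 mF FM.
have F0 w : 0 <= F w by case/andP : (FM w).
have FMn w : `|F w| <= M by rewrite ger0_norm//; case/andP : (FM w).
have mF' := filtration_measurable_fun mF.
set E1 := \int[Q]_w (X t w * F w).
have E10 : 0 <= E1 by apply: Rintegral_ge0 => w _; rewrite mulr_ge0// X0.
set c := tilted_mean t F.
have c0 : 0 <= c by rewrite /c /tilted_mean mulr_ge0 ?invr_ge0 ?(ltW x0)// mulr_ge0// expR_ge0.
have cE : x * c = expR (alpha * t) * E1 by rewrite /c /tilted_mean mulVKf ?gt_eqF.
(* The logarithmic error allowed, [c * expR eta <= c + e], with [c + 1] because [c] may be 0. One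
   half is spent on the Gronwall factor, the other on [expR (- x * rate a)]. *)
pose eta := ln (1 + e / (c + 1)).
have c1 : 0 < c + 1 by lra.
have ec0 : 0 < e / (c + 1) by rewrite divr_gt0.
have eta0 : 0 < eta by rewrite ln_gt0// ltrDl.
have etaE : c * expR eta <= c + e.
  rewrite /eta lnK ?posrE; last by lra.
  rewrite mulrDr mulr1 lerD2l mulrCA ger_pMr// ler_pdivrMr//; lra.
have t1 : 0 < 2 * (t + 1) by lra.
(* This choice gives [Lam p0 * t <= alpha * t + eta / 2]; the [t + 1] allows for [t = 0]. *)
have [p0 p00 Lp0] := Lam_near0 (divr_gt0 eta0 t1).
(* The second term of the minimum ensures [x * rate a <= eta / 2]. *)
have e00 : 0 < Num.min p0 (eta / (2 * x)) by rewrite lt_min p00 divr_gt0// mulr_gt0.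
have [r1 r10 hr1] := rate_cvg0 e00.
(* The shift by [t] makes [rate (a - t)] small, and not only [rate a]. *)
exists (r1 + t); first by rewrite ltr_pwDl.
have ce0 : 0 <= c + e by lra.
apply: (le_integral_preimage_half_line mT mF' F0) => //.
  by rewrite /= probability_setT ltry.
move=> a b ra ab.
have at0 : 0 < a - t by lra.
have bt0 : 0 < b - t by lra.
have a0 : 0 < a by lra.
have b0 : 0 < b by lra.
have ta : t < a by lra.
apply: (le_trans (integral_clock_le t0 ta ab mF FM)).
have -> : (\int[Q]_w (X t w * F w)%:E = E1%:E)%E.
  by rewrite /E1 /Rintegral fineK//; exact: integrable_fin_num (integrable_moment t0 mF' FMn).
suff : (((rate (a - t) - rate (b - t)) * E1)%:E
    <= (c + e)%:E * Q (T @^-1` `]a, b]%classic))%E by rewrite EFinM.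
rewrite prob_clock// -EFinM lee_fin.
have r1a : r1 <= a - t by lra.
have := hr1 _ r1a; rewrite le_min => /andP[pp0 _].
have r1a' : r1 <= a by lra.
have := hr1 _ r1a'; rewrite le_min => /andP[_ va].
have ab' : a - t <= b - t by rewrite lerD2r.
have qp := rate_nonincr at0 ab'.
have vab := rate_nonincr a0 ab.
have pg := rate_gt0 at0; have qg := rate_gt0 bt0.
have := cumulant_gronwall PhiS v_sol v_homo t0 (ltW qg) qp.
have sh := extinction_rate_shift PhiS flow_bounded v_sol v_homo.
rewrite -(sh _ _ at0 t0) -(sh _ _ bt0 t0) !subrK => gw.
have hL : expR (Lam (rate (a - t)) * t) <= expR (alpha * t) * expR (eta / 2).
  rewrite -expRD ler_expR.
  have h1 := slope_nondecr PhiS (ltW pg) pp0.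
  apply: (@le_trans _ _ ((alpha + eta / (2 * (t + 1))) * t)).
    by rewrite ler_wpM2r// (le_trans h1).
  rewrite mulrDl lerD2l invfM mulrA -mulrA ger_pMr ?divr_gt0//.
  by rewrite mulrC ler_pdivrMr; lra.
have gw2 : rate (a - t) - rate (b - t) <=
    (rate a - rate b) * (expR (alpha * t) * expR (eta / 2)).
  by apply: (le_trans gw); rewrite ler_wpM2l// subr_ge0.
have low := expR_increment_ge (ltW (rate_gt0 b0)) vab.
have xva : expR (- (eta / 2)) <= expR (- x * rate a).
  rewrite ler_expR mulNr lerN2.
  move: va; rewrite ler_pdivlMr ?mulr_gt0//; lra.
have low2 : x * (rate a - rate b) * expR (- (eta / 2)) <=
    expR (- x * rate b) - expR (- x * rate a).
  apply: le_trans low; rewrite ler_wpM2l// mulr_ge0 ?(ltW x0)// subr_ge0//.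
apply: (@le_trans _ _ ((rate a - rate b) * (expR (alpha * t) * expR (eta / 2)) * E1)).
  by rewrite ler_wpM2r.
apply: (@le_trans _ _ ((c * expR eta) * (x * (rate a - rate b) * expR (- (eta / 2))))).
  have ee : expR eta * expR (- (eta / 2)) = expR (eta / 2).
    by rewrite -expRD; congr expR; lra.
  have -> : (c * expR eta) * (x * (rate a - rate b) * expR (- (eta / 2)))
      = (rate a - rate b) * ((x * c) * (expR eta * expR (- (eta / 2)))) by ring.
  by rewrite ee cE; lra.
apply: ler_pM => //.
- by rewrite mulr_ge0// expR_ge0.
- by rewrite mulr_ge0 ?expR_ge0// mulr_ge0 ?(ltW x0)// subr_ge0.
Qed.

Lemma conditional_upper (t M e : R) (F : Omega -> R) : 0 <= t -> 0 < e ->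
  filtration_measurable X t F -> (forall w, `|F w| <= M) ->
  exists2 r0, 0 < r0 & forall B : set R, measurable B -> B `<=` `]r0, +oo[ ->
    \int[Q]_(w in T @^-1` B) F w <= (tilted_mean t F + e) * fine (Q (T @^-1` B)).
Proof.
move=> t0 e0 mF FM; have mF' := filtration_measurable_fun mF.
have M0 : 0 <= M := le_trans (normr_ge0 _) (FM point).
pose F1 w := F w + M.
have mF1 : filtration_measurable X t F1.
  move=> A [B mB <-]; apply: mF.
  exists ((fun y => y + M) @^-1` B) => //.
  rewrite -[X in measurable X]setTI.
  by apply: (_ : measurable_fun setT (fun y : R => y + M)) => //; exact: measurable_funD.
have F1M w : 0 <= F1 w <= 2 * M.
  by have := FM w; rewrite /F1 ler_norml; lra.
have [r0 r00 hr0] := conditional_upper_ge0 t0 e0 mF1 F1M.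
exists r0 => // B mB Br0; have := hr0 B mB Br0.
set S := T @^-1` B; have mS : measurable S by exact: mTB.
have QS : Q S \is a fin_num by exact: fin_num_measure.
have iF := integrable_F mS mF' FM.
have iM : Q.-integrable S (EFin \o cst M) by exact: finite_measure_integrable_cst.
have F1E : (\int[Q]_(w in S) (F1 w)%:E = (\int[Q]_(w in S) F w + M * fine (Q S))%:E)%E.
  rewrite -Rintegral_cst// -RintegralD// /Rintegral fineK//.
  exact: integrable_fin_num (integrableD mS iF iM).
rewrite F1E -{2}(fineK QS) -EFinM lee_fin => h.
have iXF := integrable_moment t0 mF' FM.
have iXM : Q.-integrable setT (EFin \o (fun w => X t w * M)).
  by apply: (@integrable_moment _ (cst M) M) => // w; rewrite ger0_norm.
have iX : Q.-integrable setT (EFin \o X t).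
  have := @integrable_moment t (cst 1) 1 t0 (measurable_cst _).
  rewrite /= (_ : (fun w => X t w * cst 1 w) = X t); last by apply/funext => w; rewrite mulr1.
  by apply => w; rewrite normr1.
have EX : \int[Q]_w X t w <= x * expR (- alpha * t).
  rewrite -lee_fin /Rintegral fineK; first exact: moment.
  exact: integrable_fin_num iX.
(* The moment bound enters here; the terms [M * fine (Q S)] on both sides then cancel. *)
have tm : tilted_mean t F1 <= tilted_mean t F + M.
  rewrite /tilted_mean.
  have -> : \int[Q]_w (X t w * F1 w) = \int[Q]_w (X t w * F w) + \int[Q]_w X t w * M.
    rewrite -RintegralZr// -RintegralD//.
    by apply: eq_Rintegral => w _; rewrite /F1 mulrDr.
  rewrite !mulrDr lerD2l mulrC ler_pdivrMr// mulrCA mulrC.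
  have : expR (alpha * t) * \int[Q]_w X t w <= x.
    rewrite -ler_pdivlMl ?expR_gt0// -expRN mulrC -mulNr; exact: EX.
  nra.
have q0 : 0 <= fine (Q S) by exact: fine_ge0.
nra.
Qed.

(** On []r1, n%:R]] the law of [T] is at least [k] times Lebesgue measure, by [clock_lower] on
    intervals and [le_measure_half_line] on Borel sets. This turns null events about [T] into null
    sets of values [r]. *)
Lemma clock_null_lebesgue (r1 : R) (B : set R) : 0 < r1 -> measurable B ->
  B `<=` `]r1, +oo[ -> Q (T @^-1` B) = 0%E -> lebesgue_measure B = 0%E.
Proof.
move=> r10 mB Br1 QB.
have bounded_part n : lebesgue_measure (B `&` `]r1, n%:R]) = 0%E.
  have [nr1|r1n] := leP n%:R r1.
    by rewrite [X in B `&` X]set_itv_ge ?setI0 ?measure0// bnd_simp -leNgt.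
  have n0 := lt_trans r10 r1n.
  have mI : measurable (`]r1, n%:R]%classic : set (measurableTypeR R)) by exact: measurable_itv.
  (* As [rate] is nonincreasing, each factor of [clock_lower] is smallest at one end of []r1,
     n%:R]]: [Phi] at [n%:R], the exponential at [r1]. *)
  pose k := x * Phi (rate n%:R) * expR (- x * rate r1).
  have k0 : 0 < k by rewrite /k !mulr_gt0 ?expR_gt0//; apply: Phi_gt0; exact: rate_gt0.
  have [mm mmE] := image_measure Q mT.
  have kV0 : 0 <= k^-1 by rewrite invr_ge0 ltW.
  pose m1 := mrestr (@lebesgue_measure R) mI.
  pose m2 := mscale (NngNum kV0) mm.
  have m2E A : m2 A = (k^-1%:E * Q (T @^-1` A))%E by rewrite -mmE.
  have QT A : measurable A -> (Q (T @^-1` A) < +oo)%E.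
    by move=> mA; rewrite -ge0_fin_numE// fin_num_measure//; exact: mTB.
  have le12 := @le_measure_half_line R r1 m1 m2.
  have : (m1 B <= m2 B)%E.
    apply: le12 => //.
    - move=> r; change (m2 `]r1, r]%classic < +oo)%E.
      by rewrite m2E lte_mul_pinfty ?lee_fin// QT//; exact: measurable_itv.
    - move=> a b r1a ab; change (m1 `]a, b]%classic <= m2 `]a, b]%classic)%E.
      rewrite m2E /m1 /mrestr.
      have -> : `]a, b]%classic `&` `]r1, n%:R]%classic = `]a, Num.min b n%:R]%classic.
        apply/seteqP; split => y /=; rewrite !in_itv/= le_min.
          by move=> [/andP[-> ->] /andP[_ ->]].
        by move=> /andP[ay /andP[-> ->]]; rewrite ay (le_lt_trans r1a ay).
      have [bna|abn] := leP (Num.min b n%:R) a.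
        by rewrite set_itv_ge ?measure0 ?mule_ge0 ?lee_fin// bnd_simp -leNgt.
      have a0 := lt_le_trans r10 r1a.
      have bn0 := lt_trans a0 abn.
      have bnn : Num.min b n%:R <= n%:R by rewrite ge_min lexx orbT.
      have low := clock_lower a0 (ltW abn).
      rewrite lebesgue_measure_itv/= lte_fin abn -EFinB.
      apply: (@le_trans _ _ (k^-1%:E * Q (T @^-1` `]a, (Num.min b n%:R)]%classic))%E).
        have Qfin : Q (T @^-1` `]a, (Num.min b n%:R)]%classic) \is a fin_num.
          by apply: fin_num_measure; apply: mTB; exact: measurable_itv.
        rewrite -(fineK Qfin) -EFinM lee_fin ler_pdivlMl//.
        apply: le_trans low; rewrite /k.
        have hP : Phi (rate n%:R) <= Phi (rate (Num.min b n%:R)).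
          by apply: (slope_homo PhiS); [exact: ltW (rate_gt0 _)|exact: rate_nonincr].
        have hE : expR (- x * rate r1) <= expR (- x * rate a).
          by rewrite ler_expR !mulNr lerN2 ler_wpM2l ?(ltW x0)// rate_nonincr.
        have -> : x * Phi (rate n%:R) * expR (- x * rate r1) * (Num.min b n%:R - a) =
          x * (Phi (rate n%:R) * (Num.min b n%:R - a)) * expR (- x * rate r1) by ring.
        have hm : 0 <= Num.min b n%:R - a by rewrite subr_ge0 ltW.
        have Pn0 := ltW (Phi_gt0 (rate_gt0 n0)).
        apply: ler_pM => //; [by rewrite !mulr_ge0 ?(ltW x0)|].
        by rewrite ler_wpM2l ?(ltW x0)// ler_wpM2r.
      rewrite lee_wpmul2l ?lee_fin//; apply: le_measure; rewrite ?inE.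
      + by apply: mTB; exact: measurable_itv.
      + by apply: mTB; exact: measurable_itv.
      + by apply: preimage_subset; apply: subset_itvl; rewrite bnd_simp ge_min lexx.
  rewrite m2E QB mule0 /m1 /mrestr => h.
  by apply/eqP; rewrite eq_le h measure_ge0.
have -> : B = \bigcup_n (B `&` `]r1, n%:R]).
  apply/seteqP; split => [y By|y [n _ []]//].
  have y0 := Br1 _ By; rewrite /= in_itv/= andbT in y0.
  exists (Num.bound y) => //; split => //; rewrite /= in_itv/= y0.
  by rewrite ltW// archi_boundP// ltW// (lt_trans r10).
apply/negligibleP.
  by apply: bigcupT_measurable => n; apply: measurableI => //; exact: measurable_itv.
apply: negligible_bigcup => n; apply/negligibleP; last exact: bounded_part.
by apply: measurableI => //; exact: measurable_itv.
Qed.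

(** Where [g] exceeds the bound of [conditional_upper] by a margin, the two estimates of one
    integral force probability 0, and [clock_null_lebesgue] applies. The identity is asked for on
    sets where [g] is bounded, so that it passes to [- g] and [- F] by pulling the sign out of the
    integral. *)
Lemma version_upper (t M e : R) (F : Omega -> R) (g : R -> R) : 0 <= t -> 0 < e ->
  filtration_measurable X t F -> (forall w, `|F w| <= M) ->
  measurable_fun setT g ->
  (forall B : set R, measurable B -> (exists K, forall y, B y -> `|g y| <= K) ->
    \int[Q]_(w in T @^-1` B) F w = \int[Q]_(w in T @^-1` B) g (T w)) ->
  exists2 r1, 0 < r1 &
    lebesgue_measure.-negligible [set r | r1 < r /\ tilted_mean t F + e < g r].
Proof.
move=> t0 e0 mF FM mg gF.
have [r1 r10 hr1] := conditional_upper t0 e0 mF FM.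
exists r1 => //; set c := tilted_mean t F + e in hr1 *.
(* The margin [n.+1%:R^-1] produces the contradiction and the ceiling [n%:R] makes [g \o T]
   integrable; the union over [n] covers all values to be excluded. *)
pose B n : set R := `]r1, +oo[ `&` g @^-1` `[c + n.+1%:R^-1, n%:R].
have mB n : measurable (B n).
  apply: measurableI; first exact: measurable_itv.
  by rewrite -[X in measurable X]setTI; exact: (mg measurableT _ (measurable_itv _)).
have Br1 n : B n `<=` `]r1, +oo[ by move=> y [].
suff neg : lebesgue_measure.-negligible (\bigcup_n B n).
  refine (negligibleS _ neg) => r [r1r cg]; have d0 : 0 < g r - c by rewrite subr_gt0.
  pose n := maxn (Num.bound (g r - c)^-1) (Num.bound `|g r|).
  have n1 : (g r - c)^-1 < n.+1%:R.
    apply: (lt_le_trans (archi_boundP _)); first by rewrite invr_ge0 ltW.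
    by rewrite ler_nat (leq_trans (leq_maxl _ (Num.bound `|g r|)))// /n.
  have n2 : g r <= n%:R.
    apply: (le_trans (ler_norm _)); apply: (le_trans (ltW (archi_boundP (normr_ge0 _)))).
    by rewrite ler_nat /n leq_maxr.
  exists n => //; split; first by rewrite /= in_itv/= r1r.
  rewrite /= in_itv/= n2 andbT -lerBrDl.
  by rewrite -[leRHS]invrK lef_pV2 ?posrE ?invr_gt0// ltW.
apply: negligible_bigcup => n; apply/negligibleP; first exact: mB.
apply: (clock_null_lebesgue r10 (mB n) (Br1 n)).
set S := T @^-1` B n; have mS : measurable S by exact: mTB.
have QS : Q S \is a fin_num by exact: fin_num_measure.
have gb y : B n y -> `|g y| <= `|c| + 1 + n%:R.
  move=> [_]; rewrite /= in_itv/= => /andP[h1 h2].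
  have i0 : 0 < n.+1%:R^-1 :> R by rewrite invr_gt0.
  have := ler_norm (- c); rewrite normrN => h3; have := normr_ge0 c => h4.
  have n0 : 0 <= n%:R :> R by [].
  move: (n.+1%:R^-1) (n%:R) (`|c|) (g y) h1 h2 i0 h3 h4 n0 => i m nc gy h1 h2 i0 h3 h4 m0.
  by rewrite ler_norml; apply/andP; split; lra.
have := hr1 _ (mB n) (Br1 n); rewrite (gF _ (mB n)); last by eexists; exact: gb.
have igT : Q.-integrable S (EFin \o (g \o T)).
  apply: measurable_bounded_integrable => //.
  - by rewrite -ge0_fin_numE.
  - apply: measurable_funTS; apply: measurableT_comp => //.
  - exists (`|c| + 1 + n%:R); split; first exact: num_real.
    by move=> y hy w Sw; apply: le_trans (ltW hy); exact: gb.
have lowS : (c + n.+1%:R^-1) * fine (Q S) <= \int[Q]_(w in S) g (T w).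
  rewrite -Rintegral_cst//; apply: le_Rintegral => //.
    exact: finite_measure_integrable_cst.
  by move=> w [_]; rewrite /= in_itv/= => /andP[].
move=> /(le_trans lowS); rewrite -/S mulrDl gerDl => h.
have q0 : 0 <= fine (Q S) by exact: fine_ge0.
have i0 : 0 < n.+1%:R^-1 :> R by rewrite invr_gt0.
have : fine (Q S) <= 0 by rewrite -(pmulr_rle0 _ i0).
by move=> q1; rewrite -(fineK QS); congr EFin; apply/eqP; rewrite eq_le q0 q1.
Qed.

Lemma survival_gt0 (r : R) : 0 < r -> 0 < fine (Q (T @^-1` `]r, +oo[)).
Proof.
move=> r0.
have r1 : r <= r + 1 by rewrite lerDl.
have low := clock_lower r0 r1.
apply: (@lt_le_trans _ _ (fine (Q (T @^-1` `]r, r + 1])))).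
  apply: lt_le_trans low; rewrite addrAC subrr add0r mulr1.
  by rewrite mulr_gt0 ?expR_gt0// mulr_gt0// Phi_gt0// rate_gt0// (lt_le_trans r0).
rewrite fine_le ?fin_num_measure//; try by apply: mTB; exact: measurable_itv.
apply: le_measure; rewrite ?inE; try by apply: mTB; exact: measurable_itv.
by apply: preimage_subset; exact: subset_itvl.
Qed.

Lemma survival_upper (t M e : R) (F : Omega -> R) : 0 <= t -> 0 < e ->
  filtration_measurable X t F -> (forall w, `|F w| <= M) ->
  exists2 r0, 0 < r0 & forall r, r0 <= r ->
    \int[Q]_(w in T @^-1` `]r, +oo[) F w / fine (Q (T @^-1` `]r, +oo[))
    <= tilted_mean t F + e.
Proof.
move=> t0 e0 mF FM; have [r0 r00 hr0] := conditional_upper t0 e0 mF FM.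
exists r0 => // r r0r; rewrite ler_pdivrMr ?survival_gt0 ?(lt_le_trans r00)//.
apply: hr0; first exact: measurable_itv.
by apply: subset_itvr; rewrite bnd_simp.
Qed.
End conditioning.

(** * From one-sided bounds to the two limits *)

Lemma branching_slope_bounds {R : realType} (alpha beta : R)
    (pi : {measure set (measurableTypeR R) -> \bar R}) : 0 <= alpha ->
  branching_mechanism alpha beta pi ->
  slope_bounds alpha (branching_slope alpha beta pi) (branching_fun alpha beta pi).
Proof.
move=> alpha0 [beta0 _ levy _]; split.
- exact: alpha0.
- exact: branching_fun0.
- exact: branching_slope_ge.
- exact: branching_slope_le.
- exact: branching_slope_nondecr.
Qed.

Theorem proposition4p14 (R : realType) (d : measure_display)
    (Omega : measurableType d) (alpha beta : R)
    (pi : {measure set (measurableTypeR R) -> \bar R})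
    (X : R -> Omega -> R) (P : R -> probability Omega R) (x lambda' : R)
    (Phi := branching_fun alpha beta pi) (H := extinction_time X) :
  branching_mechanism alpha beta pi ->
  CB_process Phi X P ->
  0 < x ->
  0 <= alpha ->
  0 < lambda' ->
  (forall l, lambda' <= l -> 0 < Phi l) ->
  (\int[lebesgue_measure]_(l in `[lambda', +oo[) ((Phi l)^-1)%:E < +oo)%E ->
  forall (t : R) (F : Omega -> R), 0 <= t ->
  filtration_measurable X t F -> bounded_fun F ->
  let L := ((x^-1)%:E
            * 'E_(P x) [fun w => (expR (alpha * t) * X t w * F w)%R])%E in
  (forall g : R -> R, cond_expectation_given (P x) F H g ->
     exists N : set R, lebesgue_measure.-negligible N /\
       (g r)%:E @[r --> within (~` N) (pinfty_nbhs R)] --> L) /\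
  (cond_expectation_event (P x) F [set w | (r%:E < H w)%E])%:E
    @[r --> pinfty_nbhs R] --> L.
Proof.
move=> BM [XP [v v_sol v_lap]] x0 alpha0 lambda'0 Phi_pos grey t F t0 mF bF L.
have PhiS := branching_slope_bounds alpha0 BM.
have Lam_near0 : forall e, 0 < e -> exists2 p, 0 < p &
    branching_slope alpha beta pi p <= alpha + e.
  by case: BM => beta0 _ levy _; exact: branching_slope_near0.
have Phi_gt0 : forall l, 0 < l -> 0 < Phi l.
  case: BM => beta0 _ levy _.
  exact: (branching_fun_gt0 alpha0 beta0 levy lambda'0 (Phi_pos _ (lexx _))).
have flow_bounded := grey_flow_bounded PhiS lambda'0 Phi_gt0 grey.
have v_homo := cumulant_homo XP v_lap.
have prob0 (y s : R) : 0 <= y -> 0 < s ->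
    P y (X s @^-1` [set 0%R]) = (expR (- y * extinction_rate v s))%:E.
  move=> y0 s0; apply: (prob_eq0 XP v_lap y0 (ltW s0)).
  exact: (cvg_extinction_rate PhiS flow_bounded v_sol v_homo).
have moment (s : R) : 0 <= s ->
    (\int[P x]_w (X s w)%:E <= (x * expR (- alpha * s))%:E)%E.
  exact: (moment_le PhiS XP v_sol v_lap (ltW x0)).
have absorb := absorption_negligible XP (prob_gt_le PhiS XP v_sol v_lap) (ltW x0).
have rate_cvg0 := extinction_rate_cvg0 PhiS Phi_gt0 flow_bounded v_sol v_homo.
have [T [N [mT mN N0 TN]]] :=
  extinction_clock XP x0 absorb (fun s => prob0 x s (ltW x0)) rate_cvg0.
have TN' w : ~ N w -> forall r, 0 < r -> (r < T w) = (X r w != 0).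
  by move=> /TN[].
have [M FM] : exists M, forall w, `|F w| <= M.
  have [M [_ hM]] := bF; exists (M + 1) => w.
  by apply: hM => //; rewrite ltrDl.
have mF' := filtration_measurable_fun XP mF.
have iXF := integrable_moment XP moment t0 mF' FM.
pose ell := tilted_mean X P x alpha t F.
have LE : L = ell%:E.
  rewrite /L /ell /tilted_mean unlock EFinM; congr (_ * _)%E.
  rewrite EFinM /Rintegral fineK; last exact: integrable_fin_num iXF.
  rewrite -integralZl//.
  by apply: eq_integral => w _; rewrite -mulrA EFinM.
pose Fn w := - F w.
have FnM w : `|Fn w| <= M by rewrite normrN.
have mFn : filtration_measurable X t Fn.
  move=> A [B mB <-]; apply: mF.
  exists ((fun y => - y) @^-1` B) => //.
  rewrite -[X in measurable X]setTI.
  by apply: (_ : measurable_fun setT (fun y : R => - y)) => //; exact: oppr_measurable.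
have ellN : tilted_mean X P x alpha t Fn = - ell.
  rewrite /ell /tilted_mean -mulrN -mulrN; congr (_ * (_ * _)).
  rewrite -mulN1r -RintegralZl//.
  by apply: eq_Rintegral => w _; rewrite /Fn mulN1r mulrN.
(* Neither [A] nor [f] is assumed measurable: both may involve [H], which is traded for [T] off the
   null set [N]. *)
have clock_eq (A : set Omega) (S : set R) (f f' : Omega -> R) :
    (forall w, ~ N w -> A w <-> S (T w)) -> (forall w, ~ N w -> f w = f' w) ->
    (\int[P x]_(w in A) (f w)%:E = \int[P x]_(w in T @^-1` S) (f' w)%:E)%E.
  move=> AS ff'; rewrite integral_mkcond [RHS]integral_mkcond.
  apply: (eq_integral_off_null mN N0) => w Nw; rewrite /patch.
  have -> : (w \in A) = (w \in T @^-1` S).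
    by apply/idP/idP; rewrite !inE => /(AS w Nw).
  by rewrite ff'.
have mTB B : measurable B -> measurable (T @^-1` B).
  by move=> mB; rewrite -[X in measurable X]setTI; exact: mT.
have upper := survival_upper PhiS Phi_gt0 Lam_near0 flow_bounded XP x0 v_sol
  v_homo prob0 moment mT mN N0 TN'.
have vupper := version_upper PhiS Phi_gt0 Lam_near0 flow_bounded XP x0 v_sol
  v_homo prob0 moment mT mN N0 TN'.
have iF S (f : Omega -> R) : measurable S -> measurable_fun setT f ->
    (forall w, `|f w| <= M) -> (P x).-integrable S (EFin \o f).
  by move=> mS mf fM; apply: integrableS (integrable_bounded (P x) mf fM).
rewrite LE; split.
- move=> g [mg gE].
  have gF B : measurable B ->
      \int[P x]_(w in T @^-1` B) F w = \int[P x]_(w in T @^-1` B) g (T w).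
    move=> mB; have := gE B mB.
    have HB w : ~ N w -> (H @^-1` (EFin @` B)) w <-> B (T w).
      move=> Nw; have [HT _ _] := TN w Nw; rewrite /preimage/= /H HT; split.
        by move=> [y By [<-]].
      by move=> BT; exists (T w).
    rewrite (clock_eq _ B F F HB)// (clock_eq _ B _ (g \o T) HB); last first.
      by move=> w Nw; have [HT _ _] := TN w Nw; rewrite /= /H HT.
    by rewrite /Rintegral => ->.
  have gFn B : measurable B -> (exists K, forall y, B y -> `|- g y| <= K) ->
      \int[P x]_(w in T @^-1` B) Fn w = \int[P x]_(w in T @^-1` B) (- g (T w)).
    move=> mB [K gK].
    have mS := mTB _ mB.
    have igT : (P x).-integrable (T @^-1` B) (EFin \o (g \o T)).
      apply: measurable_bounded_integrable => //.
      + by rewrite -ge0_fin_numE// fin_num_measure.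
      + by apply: measurable_funTS; apply: measurableT_comp.
      + exists K; split; first exact: num_real.
        by move=> y hy w Sw; apply: le_trans (ltW hy); rewrite -normrN; exact: gK.
    have opp f : (P x).-integrable (T @^-1` B) (EFin \o f) ->
        \int[P x]_(w in T @^-1` B) - f w = - \int[P x]_(w in T @^-1` B) f w.
      move=> ifB; rewrite -mulN1r -RintegralZl//.
      by apply: eq_Rintegral => w _; rewrite mulN1r.
    by rewrite /Fn (opp F (iF _ _ mS mF' FM)) gF// (opp (g \o T)).
  have mgn : measurable_fun setT (fun y => - g y) by exact: measurable_funN.
  (* The upper bounds for [F] and [- F] combine into a two-sided bound with error [n.+1%:R^-1], off
     a null set and beyond a threshold depending on [n]. *)
  have bad n : exists2 r1, 0 < r1 & lebesgue_measure.-negligible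
      [set r | r1 < r /\ (ell + n.+1%:R^-1 < g r \/ g r < ell - n.+1%:R^-1)].
    have e0 : 0 < n.+1%:R^-1 :> R by rewrite invr_gt0.
    have [r1 r10 neg1] := vupper t M _ F g t0 e0 mF FM mg (fun B mB _ => gF B mB).
    have [r2 r20 neg2] := vupper t M _ Fn _ t0 e0 mFn FnM mgn gFn.
    exists (Num.max r1 r2); first by rewrite lt_max r10.
    refine (negligibleS _ (negligibleU neg1 neg2)) => r.
    rewrite /= gt_max ellN => -[/andP[h1 h2] [h|h]]; [by left|right; split => //].
    by rewrite ltrNr opprD opprK.
  have /choice [r1 hr1] : forall n, exists r1, lebesgue_measure.-negligible
      [set r | r1 < r /\ (ell + n.+1%:R^-1 < g r \/ g r < ell - n.+1%:R^-1)].
    by move=> n; have [r _ hr] := bad n; exists r.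
  (* The thresholds [r1 n] vary with the accuracy, but one countable union of null sets serves every
     accuracy. *)
  exists (\bigcup_n
    [set r | r1 n < r /\ (ell + n.+1%:R^-1 < g r \/ g r < ell - n.+1%:R^-1)]).
  split; first exact: negligible_bigcup.
  apply/cvg_EFin; first exact: nearW.
  apply/cvgrPdist_le => e e0.
  have [n _ /(_ n (leqnn n))] := (@cvgr_dist_lt _ _ _ _ _ (@harmonic R) 0 (@cvg_harmonic R)) _ e0.
  rewrite /harmonic/= sub0r normrN ger0_norm ?invr_ge0// => ne.
  exists (r1 n); split; first exact: num_real.
  move=> r r1r Nr /=; rewrite ler_distlC.
  have [h1|h1] := ltP (ell + n.+1%:R^-1) (g r).
    by exfalso; apply: Nr; exists n => //; split => //; left.
  have [h2|h2] := ltP (g r) (ell - n.+1%:R^-1).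
    by exfalso; apply: Nr; exists n => //; split => //; right.
  by rewrite (le_trans _ h2) ?(le_trans h1)//= ?lerD2l ?lerN2 ltW.
- have ratioE r : 0 < r -> forall f, (forall w, `|f w| <= M) ->
      cond_expectation_event (P x) f [set w | (r%:E < H w)%E] =
      \int[P x]_(w in T @^-1` `]r, +oo[) f w / fine (P x (T @^-1` `]r, +oo[)).
    move=> r0 f fM; rewrite /cond_expectation_event unlock.
    have HB w : ~ N w -> (r%:E < H w)%E <-> `]r, +oo[%classic (T w).
      by move=> Nw; have [HT _ _] := TN w Nw; rewrite /H HT lte_fin /= in_itv/= andbT.
    (* One formula for numerator and denominator, the latter with [h = cst 1]. *)
    have ind (h : Omega -> R) :
        (\int[P x]_w (h w * \1_[set w | (r%:E < H w)%E] w)%:E =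
         \int[P x]_(w in T @^-1` `]r, +oo[%classic) (h w)%:E)%E.
      rewrite -(clock_eq [set w | (r%:E < H w)%E] _ h h)//.
      rewrite [RHS]integral_mkcond; apply: eq_integral => w _.
      by rewrite indicE /patch; case: ifP => _; rewrite ?mulr1 ?mulr0.
    congr (fine _ / fine _); first exact: ind.
    have := ind (cst 1); under eq_integral do rewrite /= mul1r.
    have mS : measurable (T @^-1` `]r, +oo[) by apply: mTB; exact: measurable_itv.
    move=> ind1; apply: (etrans ind1).
    exact: (etrans (integral_cst (P x) mS 1%E) (mul1e _)).
  apply/cvg_EFin; first exact: nearW.
  apply/cvgrPdist_le => e e0.
  have [r1 r10 h1] := upper t M e F t0 e0 mF FM.
  have [r2 r20 h2] := upper t M e Fn t0 e0 mFn FnM.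
  exists (Num.max r1 r2); split; first exact: num_real.
  move=> r; rewrite gt_max => /andP[r1r r2r] /=.
  have r0 := lt_trans r10 r1r.
  rewrite ratioE//; have := h1 r (ltW r1r); have := h2 r (ltW r2r).
  have mS : measurable (T @^-1` `]r, +oo[) by apply: mTB; exact: measurable_itv.
  have -> : \int[P x]_(w in T @^-1` `]r, +oo[) Fn w =
      - \int[P x]_(w in T @^-1` `]r, +oo[) F w.
    rewrite -mulN1r -RintegralZl//; last exact: (iF _ _ mS mF' FM).
    by apply: eq_Rintegral => w _; rewrite mulN1r.
  rewrite ellN mulNr -/ell ler_distl.
  by move=> lo up; rewrite lerBlDr up/= -lerN2 opprD lerBlDr.
Qed.
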